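(* Let $T_1$ and $T_2$ be top-down tree transducers such that the output alphabet of $T_1$ equals the input alphabet of $T_2$. It is decidable whether or not the composition $T_1\circ T_2$ is functional, i.e., whether the relation $\mathcal{R}(T_1)\circ\mathcal{R}(T_2)$ is a (partial) function.
   Context: A ranked alphabet $\Sigma$ is a finite set of symbols, each with a rank $k\geq 0$; $\Sigma_k$ denotes the symbols of rank $k$, and $T_\Sigma$ the set of trees $a(t_1,\dots,t_k)$ with $a\in\Sigma_k$, $t_i\in T_\Sigma$. For a set $B$, $T_\Sigma[B]$ denotes trees over $\Sigma$ in which elements of $B$ may additionally occur as rank-$0$ symbols. A top-down tree transducer is a tuple $T=(Q,\Sigma,\Delta,R,q_0)$ with finite state set $Q$, input and output ranked alphabets $\Sigma,\Delta$ (disjoint from $Q$), initial state $q_0\in Q$, and a finite set $R$ of rules $q(a(x_1,\dots,x_k))\to t$ with $q\in Q$, $a\in\Sigma_k$, $t\in T_\Delta[\{q'(x_i)\mid q'\in Q, i\in[k]\}]$; rules are used as rewrite rules in the usual way (a subterm $q(a(s_1,\dots,s_k))$ is replaced by $t$ with every $q'(x_i)$ replaced by $q'(s_i)$). $T(s)$ is the set of trees in $T_\Delta$ derivable from $q_0(s)$, and $\mathcal{R}(T)=\{(s,t)\mid t\in T(s)\}$. Relations compose as $\mathcal{R}_1\circ\mathcal{R}_2=\{(s,u)\mid \exists t: (s,t)\in\mathcal{R}_1, (t,u)\in\mathcal{R}_2\}$. *)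

(* Defs.v *)
From Stdlib Require Import Relations List.
From mathcomp Require Import all_boot.
Set Implicit Arguments. Unset Strict Implicit. Unset Printing Implicit Defensive.

Inductive prf : Type :=
| PZero : prf
| PSucc : prf
| PProj : nat -> prf
| PComp : prf -> seq prf -> prf
| PRec  : prf -> prf -> prf
| PMu   : prf -> prf.

Inductive peval : prf -> seq nat -> nat -> Prop :=
| ev_zero xs : peval PZero xs 0
| ev_succ x xs : peval PSucc (x :: xs) x.+1
| ev_proj i xs : i < size xs -> peval (PProj i) xs (nth 0 xs i)
| ev_comp f gs xs ys y :
    pevals gs xs ys -> peval f ys y -> peval (PComp f gs) xs y
| ev_rec0 f g xs y : peval f xs y -> peval (PRec f g) (0 :: xs) y
| ev_recS f g n xs r y :
    peval (PRec f g) (n :: xs) r -> peval g (n :: r :: xs) y ->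
    peval (PRec f g) (n.+1 :: xs) y
| ev_mu f xs n :
    peval f (n :: xs) 0 ->
    (forall m, m < n -> exists k, peval f (m :: xs) k.+1) ->
    peval (PMu f) xs n
with pevals : seq prf -> seq nat -> seq nat -> Prop :=
| evs_nil xs : pevals [::] xs [::]
| evs_cons g gs xs y ys :
    peval g xs y -> pevals gs xs ys -> pevals (g :: gs) xs (y :: ys).

(* A ranked alphabet is a finite list of (symbol, rank) pairs, each symbol
   having a unique rank. *)
Definition ralph := seq (nat * nat).
Definition ralph_wf (S : ralph) : Prop := uniq (map fst S).

Inductive tree : Type := Nd : nat -> seq tree -> tree.

Inductive in_T (S : ralph) : tree -> Prop :=
| in_T_nd a ts : (a, size ts) \in S -> Forall (in_T S) ts -> in_T S (Nd a ts).

(* Right-hand sides: GenTree.Node b cs is the output symbol b applied to cs,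
   GenTree.Leaf (q, i) is q(x_{i+1}) (variables indexed from 0). *)
Definition rhs := GenTree.tree (nat * nat).

Definition tdt := (seq nat * ralph * ralph * seq (nat * nat * rhs) * nat)%type.
Definition tstates (T : tdt) : seq nat := T.1.1.1.1.
Definition tin (T : tdt) : ralph := T.1.1.1.2.
Definition tout (T : tdt) : ralph := T.1.1.2.
Definition trules (T : tdt) : seq (nat * nat * rhs) := T.1.2.
Definition tinit (T : tdt) : nat := T.2.

Inductive rhs_ok (Q : seq nat) (D : ralph) (k : nat) : rhs -> Prop :=
| rhs_leaf q i : q \in Q -> i < k -> rhs_ok Q D k (GenTree.Leaf (q, i))
| rhs_node b cs : (b, size cs) \in D -> Forall (rhs_ok Q D k) cs ->
                  rhs_ok Q D k (GenTree.Node b cs).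

Definition tdt_wf (T : tdt) : Prop :=
  [/\ uniq (tstates T), ralph_wf (tin T), ralph_wf (tout T),
      tinit T \in tstates T &
      forall q a r, (q, a, r) \in trules T ->
        q \in tstates T /\
        exists k, (a, k) \in tin T /\ rhs_ok (tstates T) (tout T) k r].

(* Sentential forms: trees over Delta in which q(s) (q a state, s an input
   tree) may occur as leaves. *)
Inductive sform : Type :=
| SNd : nat -> seq sform -> sform
| SCall : nat -> tree -> sform.

Fixpoint to_sform (t : tree) : sform :=
  match t with Nd a ts => SNd a (map to_sform ts) end.

Fixpoint inst (ss : seq tree) (r : rhs) : sform :=
  match r with
  | GenTree.Leaf (q, i) => SCall q (nth (Nd 0 [::]) ss i)
  | GenTree.Node b cs => SNd b (map (inst ss) cs)
  end.

Inductive tstep (T : tdt) : sform -> sform -> Prop :=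
| step_root q a ss r :
    (q, a, r) \in trules T -> tstep T (SCall q (Nd a ss)) (inst ss r)
| step_ctx b l x y rs :
    tstep T x y -> tstep T (SNd b (l ++ x :: rs)) (SNd b (l ++ y :: rs)).

Definition trel (T : tdt) (s t : tree) : Prop :=
  in_T (tin T) s /\ in_T (tout T) t /\
  clos_refl_trans sform (tstep T) (SCall (tinit T) s) (to_sform t).

Definition rcomp (R1 R2 : tree -> tree -> Prop) (s u : tree) : Prop :=
  exists t, R1 s t /\ R2 t u.

Definition functional_rel (R : tree -> tree -> Prop) : Prop :=
  forall s u1 u2, R s u1 -> R s u2 -> u1 = u2.

(* Main.v *)
Require Import Defs.
From Stdlib Require Import List Relations.
From mathcomp Require Import all_boot boolp zify.
(** Functionality and its negation are both recursively enumerable, and the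
    program searches for a witness of either.

    For an input tree [s], an item records, for every [T1]-state [q] and every
    tree [t] that [T1] can output on [s] from [q], the table of all results of
    [T2] on [t]. The item of [a(s1,...,sk)] is a function [trans] of the items
    of the [si], so non-functionality shows up in some item computed bottom-up.

    A certificate of functionality is a finite set of symbolic items, whose
    results are terms with variables or marked unknown, closed under [trans] up
    to substitution. To see that a functional composition has one, classify [s]
    by the pairs [(q, P)] such that [T1] outputs on [s] from [q] some [t] on
    which exactly the [T2]-states in [P] are defined. On the inputs of a class,
    call a triple [(q, P, p)] known if the result of [p] is independent of the
    choice of such a [t]. By exchanging subtrees, the known triples of
    [a(s1,...,sk)] are computed from known triples of the [si] only. The values
    of the known triples satisfy a set of term equations, which has a most
    general solution because unification eliminates a variable at each step;
    these solutions, one for each class, form the certificate. *)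

Set Implicit Arguments. Unset Strict Implicit. Unset Printing Implicit Defensive.

(** * Recursive functions on numbers *)

(** A functional composition may be ambiguous inside: on a subtree [T1] may offer several outputs on
    which a [T2]-state gives different results, provided that these results never reach the final
    tree. So a certificate must be able to leave results unknown. Whether a derivation survives also
    depends on which [T2]-states are defined on an intermediate tree; this is why classes record the
    set [P]: replacing an output by another one with the same [P] leaves the domain of [T2] on every
    enclosing tree unchanged. Known values still grow without bound over the inputs of a class, so a
    finite object can only record how they depend on each other. One value may arise from
    syntactically different terms; a most general solution turns equality of values on all inputs
    into equality of terms, which a program can test. The existence of a certificate is proved
    classically and without a bound on its size. Classes and known triples are never computed; the
    program relies only on one of the two searches succeeding. *)

Definition prn (n : nat) (f : seq nat -> nat) : Prop :=
  exists p, forall xs, size xs = n -> peval p xs (f xs).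

Lemma eq_prn n f g : (forall xs, size xs = n -> f xs = g xs) -> prn n f -> prn n g.
Proof. by move=> e [p Hp]; exists p => xs sx; rewrite -e //; apply: Hp. Qed.

Lemma prn_proj n i : i < n -> prn n (nth 0 ^~ i).
Proof. by move=> lt_in; exists (PProj i) => xs sx; constructor; rewrite sx. Qed.

Lemma prn_comp1 n f g : prn 1 (fun ys => f (nth 0 ys 0)) -> prn n g ->
  prn n (fun xs => f (g xs)).
Proof.
move=> [p Hp] [q Hq]; exists (PComp p [:: q]) => xs sx.
apply: (ev_comp (ys := [:: g xs])); last exact: (Hp [:: _]).
by repeat constructor; apply: Hq.
Qed.

Lemma prn_comp2 n f g h : prn 2 (fun ys => f (nth 0 ys 0) (nth 0 ys 1)) ->
  prn n g -> prn n h -> prn n (fun xs => f (g xs) (h xs)).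
Proof.
move=> [p Hp] [q Hq] [r Hr]; exists (PComp p [:: q; r]) => xs sx.
apply: (ev_comp (ys := [:: g xs; h xs])); last exact: (Hp [:: _; _]).
by repeat constructor; [apply: Hq | apply: Hr].
Qed.

Lemma prn_const n k : prn n (fun=> k).
Proof.
elim: k => [|k [p Hp]]; first by exists PZero => xs _; constructor.
exists (PComp PSucc [:: p]) => xs sx; apply: (ev_comp (ys := [:: k])).
  by repeat constructor; apply: Hp.
by constructor.
Qed.

Lemma prn_succ n f : prn n f -> prn n (fun xs => (f xs).+1).
Proof.
move=> [p Hp]; exists (PComp PSucc [:: p]) => xs sx.
by apply: (ev_comp (ys := [:: f xs])); repeat constructor; apply: Hp.
Qed.

Lemma prn_rec n f g h : prn n f -> prn n.+2 g ->
  (forall xs, h (0 :: xs) = f xs) ->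
  (forall k xs, h (k.+1 :: xs) = g [:: k, h (k :: xs) & xs]) ->
  prn n.+1 h.
Proof.
move=> [p Hp] [q Hq] h0 hS; exists (PRec p q) => [[//|k xs]] [sx].
elim: k => [|k IH]; first by rewrite h0; constructor; apply: Hp.
by rewrite hS; apply: ev_recS IH _; apply: Hq; rewrite /= sx.
Qed.

Lemma prn_mu n f h : prn n.+1 f ->
  (forall xs, size xs = n ->
     f (h xs :: xs) = 0 /\ forall m, m < h xs -> f (m :: xs) != 0) ->
  prn n h.
Proof.
move=> [p Hp] hP; exists (PMu p) => xs sx; have [h0 hlt] := hP _ sx.
constructor; first by rewrite -[in X in peval _ _ X]h0; apply: Hp; rewrite /= sx.
move=> m /hlt; have := Hp (m :: xs); rewrite /= sx => /(_ erefl).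
by case: (f _) => // k Hk _; exists k.
Qed.

Lemma prn_add : prn 2 (fun xs => nth 0 xs 0 + nth 0 xs 1).
Proof.
apply: (@prn_rec 1 (nth 0 ^~ 0) (fun xs => (nth 0 xs 1).+1)) => //.
- exact: prn_proj.
- exact/prn_succ/prn_proj.
Qed.

Lemma prn_mul : prn 2 (fun xs => nth 0 xs 0 * nth 0 xs 1).
Proof.
apply: (@prn_rec 1 (fun=> 0) (fun xs => nth 0 xs 2 + nth 0 xs 1)) => //.
- exact: prn_const.
- by apply: prn_comp2 prn_add _ _; apply: prn_proj.
Qed.

Lemma prn_pow2 : prn 1 (fun xs => 2 ^ nth 0 xs 0).
Proof.
apply: (@prn_rec 0 (fun=> 1) (fun xs => nth 0 xs 1 + nth 0 xs 1)) => //.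
- exact: prn_const.
- by apply: prn_comp2 prn_add _ _; apply: prn_proj.
- by move=> k xs /=; rewrite expnS; lia.
Qed.

Lemma prn_pred : prn 1 (fun xs => (nth 0 xs 0).-1).
Proof.
apply: (@prn_rec 0 (fun=> 0) (fun xs => nth 0 xs 0)) => //.
- exact: prn_const.
- exact: prn_proj.
Qed.

(** Arguments are reversed because [PRec] recurses on the first one; [prn_sub] swaps them back. *)
Lemma prn_rsub : prn 2 (fun xs => nth 0 xs 1 - nth 0 xs 0).
Proof.
apply: (@prn_rec 1 (nth 0 ^~ 0) (fun xs => (nth 0 xs 1).-1)).
- exact: prn_proj.
- by apply: prn_comp1 prn_pred _; apply: prn_proj.
- by move=> xs /=; rewrite subn0.
- by move=> k xs /=; rewrite subnS.
Qed.

Lemma prn_sub n f g : prn n f -> prn n g -> prn n (fun xs => f xs - g xs).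
Proof. by move=> Hf Hg; apply: (prn_comp2 (f := fun x y => y - x) prn_rsub Hg Hf). Qed.

Lemma prn_eq n f g : prn n f -> prn n g -> prn n (fun xs => (f xs == g xs) : nat).
Proof.
move=> Hf Hg.
apply: (@eq_prn _ (fun xs => 1 - ((f xs - g xs) + (g xs - f xs)))).
  by move=> xs _; case: eqP => /=; lia.
apply: prn_sub; first exact: prn_const.
by apply: prn_comp2 prn_add _ _; apply: prn_sub.
Qed.

(** The remainder as a counter that is reset on reaching [d]; for [d = 0] it is never reset, in
    accordance with [k %% 0 = k]. *)
Lemma modnS_rec k d : k.+1 %% d = (k %% d).+1 * (1 - ((k %% d).+1 == d)).
Proof.
rewrite modnS; have [->|d0] := posnP d; first by rewrite !modn0 dvd0n /= muln1.
have ->: (d %| k.+1) = ((k %% d).+1 == d); last by case: eqP => _; rewrite ?muln0 ?muln1.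
rewrite {1}(divn_eq k d) -addnS dvdn_addr ?dvdn_mull //.
have := ltn_pmod k d0; rewrite leq_eqVlt => /orP[/eqP-> | lt_kd].
  by rewrite dvdnn eqxx.
by rewrite gtnNdvd //; apply/esym/negbTE; rewrite neq_ltn lt_kd.
Qed.

Lemma prn_mod n f g : prn n f -> prn n g -> prn n (fun xs => f xs %% g xs).
Proof.
apply: prn_comp2.
apply: (@prn_rec 1 (fun=> 0)
  (fun xs => (nth 0 xs 1).+1 * (1 - ((nth 0 xs 1).+1 == nth 0 xs 2)))).
- exact: prn_const.
- apply: prn_comp2 prn_mul _ _; first exact/prn_succ/prn_proj.
  apply: prn_sub; first exact: prn_const.
  by apply: prn_eq; [apply/prn_succ/prn_proj | apply: prn_proj].
- by move=> xs /=; rewrite mod0n.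
- by move=> k xs /=; rewrite modnS_rec.
Qed.

Lemma prn_div n f g : prn n f -> prn n g -> prn n (fun xs => f xs %/ g xs).
Proof.
apply: prn_comp2.
apply: (@prn_rec 1 (fun=> 0)
  (fun xs => nth 0 xs 1 + (1 - (nth 0 xs 0).+1 %% nth 0 xs 2) *
     (1 - (nth 0 xs 2 == 0)))).
- exact: prn_const.
- apply: prn_comp2 prn_add _ _; first exact: prn_proj.
  apply: prn_comp2 prn_mul _ _.
    apply: prn_sub; first exact: prn_const.
    by apply: prn_mod; [apply/prn_succ/prn_proj | apply: prn_proj].
  apply: prn_sub; first exact: prn_const.
  by apply: prn_eq; [apply: prn_proj | apply: prn_const].
- by move=> xs /=; rewrite div0n.
- move=> k xs /=; case: (posnP (nth 0 xs 0)) => [->|d0]; first by rewrite !divn0 /= muln0.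
  rewrite divnS // /dvdn; case: (nth 0 xs 0) d0 => // d _ /=.
  by rewrite muln1 addnC; case: (_ %% _).
Qed.

(** One step of MathComp's [CodeSeq.code], through which lists are pickled. The head is the exponent
    of 2, the tail is half of the odd part, rounded down. *)
Definition ccons (x m : nat) := 2 ^ x * m.*2.+1.
Definition chead (n : nat) := logn 2 n.
Definition ctail (n : nat) := n %/ 2 ^ (chead n).+1.

Lemma logn_ccons x m : logn 2 (ccons x m) = x.
Proof.
rewrite /ccons lognM ?expn_gt0 // lognX logn_prime // muln1.
by rewrite logn_coprime ?addn0 // coprime2n /= odd_double.
Qed.

Lemma chead_ccons x m : chead (ccons x m) = x.
Proof. exact: logn_ccons. Qed.

Lemma ctail_ccons x m : ctail (ccons x m) = m.
Proof.
rewrite /ctail chead_ccons /ccons expnSr divnMA mulKn ?expn_gt0 // divn2.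
by rewrite -[_.+1]add1n halfD odd_double /= doubleK add0n.
Qed.

Lemma prn_ccons : prn 2 (fun xs => ccons (nth 0 xs 0) (nth 0 xs 1)).
Proof.
apply: (@eq_prn _ (fun xs => 2 ^ nth 0 xs 0 * (nth 0 xs 1 + nth 0 xs 1).+1)).
  by move=> xs _; rewrite /ccons addnn.
apply: prn_comp2 prn_mul _ _.
  by apply: prn_comp1 prn_pow2 _; apply: prn_proj.
by apply/prn_succ/(prn_comp2 prn_add); apply: prn_proj.
Qed.

Lemma prn_chead : prn 1 (fun xs => chead (nth 0 xs 0)).
Proof.
(* Vanishes at the first exponent whose successor power no longer divides. All powers divide 0, so 0
   is replaced by 1, which has the same [chead]. *)
pose f xs : nat :=
  (nth 0 xs 1 + (nth 0 xs 1 == 0)) %% 2 ^ (nth 0 xs 0).+1 == 0.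
apply: (@prn_mu 1 f).
  apply: prn_eq; last exact: prn_const.
  apply: prn_mod.
    apply: prn_comp2 prn_add _ _; first exact: prn_proj.
    by apply: prn_eq; [apply: prn_proj | apply: prn_const].
  by apply: (prn_comp1 prn_pow2); apply/prn_succ/prn_proj.
move=> [|n [|? ?]] //= _; rewrite /f /=.
have -> : chead n = chead (n + (n == 0)).
  by case: n => [|n] //=; rewrite ?addn0 // /chead logn1.
have: 0 < n + (n == 0) by case: n => // n; rewrite addn0.
move: (n + _) => {}n n0; rewrite -/(_ %| _) -/(chead n); split.
  by rewrite -/(dvdn _ _) pfactor_dvdn // ltnn.
by move=> m lt_m; rewrite -/(dvdn _ _) pfactor_dvdn // lt_m.
Qed.

Lemma prn_ctail : prn 1 (fun xs => ctail (nth 0 xs 0)).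
Proof.
apply: prn_div; first exact: prn_proj.
apply: (prn_comp1 prn_pow2); apply/prn_succ/prn_chead.
Qed.

(** * Computable functions on encoded data *)

(** Outside [D] the program may diverge or return anything; this is what the branches of a lazy
    conditional require. *)
Definition computable_on (A B : countType) (D : A -> Prop) (f : A -> B) : Prop :=
  exists p, forall x, D x -> peval p [:: pickle x] (pickle (f x)).

Definition computable (A B : countType) (f : A -> B) : Prop :=
  exists p, forall x, peval p [:: pickle x] (pickle (f x)).

Lemma eq_computable (A B : countType) (f g : A -> B) : f =1 g -> computable f -> computable g.
Proof. by move=> e [p Hp]; exists p => x; rewrite -e. Qed.

Lemma computable_onW (A B : countType) (D : A -> Prop) (f : A -> B) :
  computable f -> computable_on D f.
Proof. by case=> p Hp; exists p => x _. Qed.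

Lemma comp_prn (A B : countType) (f : A -> B) h :
  prn 1 h -> (forall x, h [:: pickle x] = pickle (f x)) -> computable f.
Proof. by move=> [p Hp] e; exists p => x; rewrite -e; apply: Hp. Qed.

Lemma prn_comp (f : nat -> nat) : prn 1 (fun xs => f (nth 0 xs 0)) -> computable f.
Proof. by move=> H; apply: (comp_prn H). Qed.

Lemma comp_id (A : countType) : computable (fun x : A => x).
Proof. by apply: (comp_prn (prn_proj (ltn0Sn 0))). Qed.

Lemma comp_const (A B : countType) (b : B) : computable (fun _ : A => b).
Proof. by apply: (comp_prn (@prn_const 1 (pickle b))). Qed.

Lemma comp_comp (A B C : countType) (g : B -> C) (f : A -> B) :
  computable g -> computable f -> computable (fun x => g (f x)).
Proof.
move=> [p Hp] [q Hq]; exists (PComp p [:: q]) => x.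
by apply: (ev_comp (ys := [:: _])); last exact: Hp; repeat constructor.
Qed.

(* Several types have the same codes: [nat] and [seq nat], [GenTree.tree T]
   and its token sequences, and so on. *)
Lemma comp_recode (A B C : countType) (f : A -> B) (g : A -> C) :
  (forall x, pickle (f x) = pickle (g x)) -> computable f -> computable g.
Proof. by move=> e [p Hp]; exists p => x; rewrite -e. Qed.

Lemma comp_nat1 (A : countType) (h : nat -> nat) (f : A -> nat) :
  prn 1 (fun xs => h (nth 0 xs 0)) -> computable f -> computable (fun x => h (f x)).
Proof. by move=> /prn_comp; apply: comp_comp. Qed.

Lemma comp_nat2 (A : countType) (h : nat -> nat -> nat) (f g : A -> nat) :
  prn 2 (fun xs => h (nth 0 xs 0) (nth 0 xs 1)) -> computable f -> computable g ->
  computable (fun x => h (f x) (g x)).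
Proof.
move=> [p Hp] [q Hq] [r Hr]; exists (PComp p [:: q; r]) => x.
apply: (ev_comp (ys := [:: f x; g x])); last exact: (Hp [:: _; _]).
by repeat constructor; [apply: Hq | apply: Hr].
Qed.

(** A number is its own code, so both sides speak of the same program. This gives access to
    arithmetic on codes. *)
Lemma comp_pickle (A B : countType) (f : A -> B) :
  computable f <-> computable (fun x => pickle (f x)).
Proof. by []. Qed.

(** The code of a pair is the code of the two-element list of the codes. *)
Lemma comp_pair (A B C : countType) (f : A -> B) (g : A -> C) :
  computable f -> computable g -> computable (fun x => (f x, g x)).
Proof.
move=> /comp_pickle Hf /comp_pickle Hg; apply/comp_pickle.
have := comp_nat2 prn_ccons Hf (comp_nat2 prn_ccons Hg (comp_const _ 0)).
exact: eq_computable.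
Qed.

Lemma comp_code_head (A B : countType) (f : A -> nat) (g : A -> B) :
  (forall x, chead (f x) = pickle (g x)) -> computable f -> computable g.
Proof.
by move=> e Hf; apply: comp_recode (comp_nat1 prn_chead Hf) => x; rewrite -e.
Qed.

Lemma comp_code_tail (A B : countType) (f : A -> nat) (g : A -> B) :
  (forall x, ctail (f x) = pickle (g x)) -> computable f -> computable g.
Proof.
by move=> e Hf; apply: comp_recode (comp_nat1 prn_ctail Hf) => x; rewrite -e.
Qed.

Lemma comp_fst (A B C : countType) (f : A -> B * C) :
  computable f -> computable (fun x => (f x).1).
Proof.
move/comp_pickle; apply: comp_code_head => x; case: (f x) => b c.
exact: (chead_ccons (pickle b)).
Qed.

Lemma comp_snd (A B C : countType) (f : A -> B * C) :
  computable f -> computable (fun x => (f x).2).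
Proof.
move=> Hf; apply: (@comp_code_head _ _ (fun x => ctail (pickle (f x)))).
  move=> x; case: (f x) => b c.
  rewrite -[pickle (b, c)]/(ccons (pickle b) (ccons (pickle c) 0)).
  by rewrite ctail_ccons chead_ccons.
by apply: comp_nat1 prn_ctail _; apply/comp_pickle.
Qed.

Lemma comp_comp2 (A B C D : countType) (h : A -> B -> C) (f : D -> A) (g : D -> B) :
  computable (fun t => h t.1 t.2) -> computable f -> computable g ->
  computable (fun x => h (f x) (g x)).
Proof. by move=> Hh Hf Hg; apply: (comp_comp Hh (comp_pair Hf Hg)). Qed.

Lemma comp_comp3 (A B C D E : countType) (h : A -> B -> C -> E)
    (f : D -> A) (g : D -> B) (k : D -> C) :
  computable (fun t => h t.1 t.2.1 t.2.2) -> computable f -> computable g -> computable k ->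
  computable (fun x => h (f x) (g x) (k x)).
Proof.
by move=> Hh Hf Hg Hk; apply: (comp_comp Hh (comp_pair Hf (comp_pair Hg Hk))).
Qed.

(** [r] works on raw codes, and only on [D] is its value the code of an argument of [g]. In this way
    the components of a list or of a sum are reached. *)
Lemma computable_on_comp (A B C : countType) (D : A -> Prop) (r : A -> nat) (g : B -> C) (f
    : A -> C) :
  computable r -> computable g ->
  (forall x, D x -> exists2 y, pickle y = r x & g y = f x) -> computable_on D f.
Proof.
move=> [p Hp] [q Hq] e; exists (PComp q [:: p]) => x /e[y ey <-].
apply: (ev_comp (ys := [:: pickle y])); last exact: Hq.
by rewrite ey; repeat constructor; apply: Hp.
Qed.

(* The branch not taken may diverge: [PRec] with base [PZero] runs its step
   program only when its first argument is nonzero. *)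
Lemma comp_if_lazy (A B : countType) (b : A -> bool) (f g : A -> B) :
  computable b -> computable_on b f -> computable_on (fun x => ~~ b x) g ->
  computable (fun x => if b x then f x else g x).
Proof.
move=> [pb Hb] [p Hp] [q Hq]; have [radd Hadd] := prn_add.
have [pn Hn] : computable (fun x => 1 - b x).
  have [] := @comp_nat2 A (fun x y => x - y) (fun=> 1) (fun x => b x : nat)
    _ (comp_const _ 1) _.
  - by apply: prn_sub; apply: prn_proj.
  - by exists pb => x; move: (Hb x); case: (b x).
  - by move=> r Hr; exists r.
pose br s := PRec PZero (PComp s [:: PProj 2]).
pose idp := PProj 0.
(* The branch not taken returns 0, so the sum is the value of the branch taken. *)
exists (PComp radd [:: PComp (br p) [:: pb; idp]; PComp (br q) [:: pn; idp]]) => x.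
have evid xs : peval idp (pickle x :: xs) (pickle x) by constructor.
have br0 s : peval (br s) [:: 0; pickle x] 0 by do 2 constructor.
have br1 s y : peval s [:: pickle x] y -> peval (br s) [:: 1; pickle x] y.
  move=> Hs; apply: ev_recS (br0 s) _; apply: (ev_comp (ys := [:: pickle x])) => //.
  by repeat constructor; apply: (@ev_proj 2 [:: 0; 0; pickle x]).
have ev2 s r n y : peval s [:: pickle x] n -> peval r [:: n; pickle x] y ->
    peval (PComp r [:: s; idp]) [:: pickle x] y.
  move=> Hs Hr; apply: (ev_comp (ys := [:: n; pickle x])) => //.
  by repeat constructor.
have := Hb x; have := Hn x; case: (boolP (b x)) => bx /= n1 n2.
- have -> : pickle (f x) = pickle (f x) + 0 by rewrite addn0.
  apply: (ev_comp (ys := [:: pickle (f x); 0])); last exact: (Hadd [:: _; _]).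
  repeat constructor; first by apply: ev2 n2 _; apply/br1/Hp.
  by apply: ev2 n1 _; apply: br0.
- have -> : pickle (g x) = 0 + pickle (g x) by [].
  apply: (ev_comp (ys := [:: 0; pickle (g x)])); last exact: (Hadd [:: _; _]).
  repeat constructor; first by apply: ev2 n2 _; apply: br0.
  by apply: ev2 n1 _; apply/br1/Hq.
Qed.

Lemma comp_if (A B : countType) (b : A -> bool) (f g : A -> B) :
  computable b -> computable f -> computable g ->
  computable (fun x => if b x then f x else g x).
Proof. by move=> Hb Hf Hg; apply: comp_if_lazy => //; apply: computable_onW. Qed.

Lemma comp_negb (A : countType) (f : A -> bool) : computable f -> computable (fun x => ~~ f x).
Proof.
move=> Hf; apply: (@eq_computable _ _ (fun x => if f x then false else true)).
  by move=> x; case: (f x).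
by apply: comp_if => //; apply: comp_const.
Qed.

Lemma comp_and (A : countType) (f g : A -> bool) :
  computable f -> computable g -> computable (fun x => f x && g x).
Proof. by move=> Hf Hg; apply: comp_if => //; apply: comp_const. Qed.

Lemma comp_or (A : countType) (f g : A -> bool) :
  computable f -> computable g -> computable (fun x => f x || g x).
Proof. by move=> Hf Hg; apply: comp_if => //; apply: comp_const. Qed.

Lemma comp_eq (A B : countType) (f g : A -> B) :
  computable f -> computable g -> computable (fun x => f x == g x).
Proof.
move=> /comp_pickle Hf /comp_pickle Hg.
have Heq : prn 2 (fun xs => (nth 0 xs 0 == nth 0 xs 1) : nat).
  by apply: prn_eq; apply: prn_proj.
apply: comp_recode (comp_nat2 (h := fun x y => (x == y) : nat) Heq Hf Hg) => x /=.
by rewrite (inj_eq (pcan_inj pickleK)); case: eqP.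
Qed.

Lemma comp_succ (A : countType) (f : A -> nat) : computable f -> computable (fun x => (f x).+1).
Proof. by apply: comp_nat1; apply/prn_succ/prn_proj. Qed.

Lemma comp_pred (A : countType) (f : A -> nat) : computable f -> computable (fun x => (f x).-1).
Proof. by apply: comp_nat1 prn_pred. Qed.

(** Pairing for programs with any number of arguments, where [computable] allows only one; inside
    loops and searches it rebuilds the single argument of such a program. *)
Lemma pair_program : exists pp : prf -> prf -> prf, forall p q xs x y,
  peval p xs x -> peval q xs y -> peval (pp p q) xs (ccons x (ccons y 0)).
Proof.
have [pc Hc] := prn_ccons.
have ev2 p q xs x y : peval p xs x -> peval q xs y -> peval (PComp pc [:: p; q]) xs (ccons x y).
  move=> Hx Hy; apply: (ev_comp (ys := [:: x; y])); last exact: (Hc [:: _; _]).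
  by apply: evs_cons Hx (evs_cons Hy (evs_nil _)).
exists (fun p q => PComp pc [:: p; PComp pc [:: q; PZero]]) => p q xs x y Hx Hy.
exact: ev2 Hx (ev2 _ _ _ _ _ Hy (ev_zero _)).
Qed.

(** [C] is a context of free variables: a body under a binder is handled by requiring its uncurried
    form to be computable. All later combinators follow this pattern. *)
Lemma comp_iter (C A : countType) (n : C -> nat) (g : C -> A -> A) (z : C -> A) :
  computable n -> computable (fun t => g t.1 t.2) -> computable z ->
  computable (fun c => iter (n c) (g c) (z c)).
Proof.
move=> [pn Hn] [pg Hg] [pz Hz]; have [pp Hpp] := pair_program.
(* The step of [PRec] receives the counter, the state and the context in this order, hence the
   projections 2 and 1. *)
exists (PComp (PRec pz (PComp pg [:: pp (PProj 2) (PProj 1)])) [:: pn; PProj 0]) => c.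
apply: (ev_comp (ys := [:: n c; pickle c])).
  apply: evs_cons (Hn c) _; apply: evs_cons (evs_nil _).
  exact: (@ev_proj 0 [:: pickle c]).
elim: (n c) => [|k IH]; first by constructor; apply: Hz.
apply: ev_recS IH _; set a := iter k _ _.
apply: (ev_comp (ys := [:: pickle (c, a)])); last exact: (Hg (c, a)).
apply: evs_cons (evs_nil _); apply: Hpp.
  exact: (@ev_proj 2 [:: k; pickle a; pickle c]).
exact: (@ev_proj 1 [:: k; pickle a; pickle c]).
Qed.

Lemma pickle_cons (A : countType) (x : A) s :
  pickle (x :: s) = ccons (pickle x) (pickle s).
Proof. by []. Qed.

Lemma comp_cons (C A : countType) (f : C -> A) (g : C -> seq A) :
  computable f -> computable g -> computable (fun c => f c :: g c).
Proof.
move=> /comp_pickle Hf /comp_pickle Hg.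
exact: comp_recode (comp_nat2 prn_ccons Hf Hg).
Qed.

Lemma comp_behead (C A : countType) (f : C -> seq A) :
  computable f -> computable (fun c => behead (f c)).
Proof.
move/comp_pickle; apply: comp_code_tail => c; case: (f c) => [|x s] //=.
by rewrite pickle_cons ctail_ccons.
Qed.

Lemma comp_seq_case (C A B : countType) (l : C -> seq A) (z : C -> B)
    (g : C -> A -> seq A -> B) :
  computable l -> computable z -> computable (fun t => g t.1 t.2.1 t.2.2) ->
  computable (fun c => if l c is x :: s then g c x s else z c).
Proof.
move=> Hl Hz Hg.
apply: (@eq_computable _ _ (fun c => if l c == [::] then z c else
    if l c is x :: s then g c x s else z c)); first by move=> c; case: (l c).
apply: comp_if_lazy; first by apply: comp_eq => //; apply: comp_const.
  exact: computable_onW.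
(* The code of [(c, (x, s))], assembled from that of [l c]; it is meaningful only if [l c] is
   nonempty. *)
pose r c := ccons (pickle c) (ccons (ccons (chead (pickle (l c)))
  (ccons (ctail (pickle (l c))) 0)) 0).
apply: (@computable_on_comp _ _ _ _ r (fun t => g t.1 t.2.1 t.2.2)) => //.
  have Hpl : computable (fun c => pickle (l c)) by apply/comp_pickle.
  have H0 : computable (fun _ : C => 0) := comp_const _ 0.
  apply: comp_nat2 prn_ccons _ _; first by apply/comp_pickle/comp_id.
  apply: (comp_nat2 prn_ccons _ H0); apply: comp_nat2 prn_ccons _ _.
    exact: comp_nat1 prn_chead Hpl.
  apply: (comp_nat2 prn_ccons _ H0); exact: comp_nat1 prn_ctail Hpl.
move=> c; rewrite /r; case: (l c) => [|x s] // _; exists (c, (x, s)) => //.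
by rewrite pickle_cons chead_ccons ctail_ccons.
Qed.

Lemma size_pickle (A : countType) (s : seq A) : size s <= pickle s.
Proof.
elim: s => //= x s IH; rewrite pickle_cons /ccons.
have := expn_gt0 2 (pickle x); move: (2 ^ _) IH => /=; nia.
Qed.

Lemma comp_foldl (C A X : countType) (l : C -> seq X) (g : C -> A -> X -> A) (z : C -> A) :
  computable (fun t => g t.1 t.2.1 t.2.2) -> computable z -> computable l ->
  computable (fun c => foldl (g c) (z c) (l c)).
Proof.
move=> Hg Hz Hl.
pose st c (a : A * seq X) := if a.2 is x :: s then (g c a.1 x, s) else a.
have iter_st c n a s : size s <= n -> iter n (st c) (a, s) = (foldl (g c) a s, [::]).
  elim: n a s => [|n IH] a [|x s] //=; last first.
    by rewrite ltnS => /IH e; rewrite -iterS iterSr; apply: e.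
  by move=> _; rewrite (IH a [::]).
apply: (@eq_computable _ _ (fun c => (iter (pickle (l c)) (st c) (z c, l c)).1)).
  by move=> c; rewrite iter_st // size_pickle.
apply: comp_fst; apply: comp_iter; first exact/comp_pickle.
  apply: comp_seq_case.
  - exact/comp_snd/comp_snd/comp_id.
  - exact/comp_snd/comp_id.
  - apply: comp_pair; last exact/comp_snd/comp_snd/comp_id.
    apply: comp_comp3 Hg _ _ _.
    + exact/comp_fst/comp_fst/comp_id.
    + exact/comp_fst/comp_snd/comp_fst/comp_id.
    + exact/comp_fst/comp_snd/comp_id.
exact: comp_pair.
Qed.

Lemma comp_rev (C X : countType) (l : C -> seq X) :
  computable l -> computable (fun c => rev (l c)).
Proof.
move=> Hl; apply: (@eq_computable _ _ (fun c => foldl (fun a x => x :: a) [::] (l c))).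
  by move=> c; rewrite -{1}[l c]revK foldl_rev; elim: (rev _) => //= x s ->.
apply: comp_foldl => //; last exact: comp_const.
by apply: comp_cons; [apply/comp_snd/comp_snd/comp_id | apply/comp_fst/comp_snd/comp_id].
Qed.

Lemma comp_foldr (C A X : countType) (g : C -> X -> A -> A) (z : C -> A) (l : C -> seq X) :
  computable (fun t => g t.1 t.2.1 t.2.2) -> computable z -> computable l ->
  computable (fun c => foldr (g c) (z c) (l c)).
Proof.
move=> Hg Hz Hl.
apply: (@eq_computable _ _ (fun c => foldl (fun a x => g c x a) (z c) (rev (l c)))).
  by move=> c; rewrite foldl_rev.
apply: comp_foldl Hz (comp_rev Hl); apply: comp_comp3 Hg _ _ _.
- exact/comp_fst/comp_id.
- exact/comp_snd/comp_snd/comp_id.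
- exact/comp_fst/comp_snd/comp_id.
Qed.

Ltac comp_step :=
  lazymatch goal with
  | |- computable (fun x => x) => exact: comp_id
  | |- computable (@fst _ _) => exact: (comp_fst (comp_id _))
  | |- computable (@snd _ _) => exact: (comp_snd (comp_id _))
  | |- computable (fun _ => ?b) => exact: comp_const
  | |- computable (fun x => fst (@?f x)) => apply: comp_fst
  | |- computable (fun x => snd (@?f x)) => apply: comp_snd
  | |- computable (fun x => pair (@?f x) (@?g x)) => apply: comp_pair
  | |- computable (fun x => cons (@?f x) (@?g x)) => apply: comp_cons
  | |- computable (fun x => S (@?f x)) => apply: comp_succ
  | |- computable (fun x => negb (@?f x)) => apply: comp_negb
  | |- computable (fun x => andb (@?f x) (@?g x)) => apply: comp_and
  | |- computable (fun x => orb (@?f x) (@?g x)) => apply: comp_or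
  | |- computable (fun x => eq_op (@?f x) (@?g x)) => apply: comp_eq
  end.
Ltac comp_auto := lazy beta; repeat (comp_step; lazy beta).

Lemma comp_cat (C X : countType) (f g : C -> seq X) :
  computable f -> computable g -> computable (fun c => f c ++ g c).
Proof.
move=> Hf Hg; apply: (@eq_computable _ _ (fun c => foldr cons (g c) (f c))).
  by move=> c; elim: (f c) => //= x s ->.
by apply: (comp_foldr (g := fun _ => cons)) => //; comp_auto.
Qed.

Lemma comp_flatten (C X : countType) (f : C -> seq (seq X)) :
  computable f -> computable (fun c => flatten (f c)).
Proof.
move=> Hf; apply: (comp_foldr (g := fun _ => cat)) => //; last exact: comp_const.
by apply: comp_cat; comp_auto.
Qed.

Lemma comp_map (C X Y : countType) (f : C -> X -> Y) (l : C -> seq X) :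
  computable (fun t => f t.1 t.2) -> computable l -> computable (fun c => map (f c) (l c)).
Proof.
move=> Hf Hl; apply: (@eq_computable _ _ (fun c => foldr (fun x s => f c x :: s) [::] (l c))).
  by move=> c; elim: (l c) => //= x s ->.
apply: comp_foldr => //; last exact: comp_const.
by apply: comp_cons; last comp_auto; apply: comp_comp2 Hf _ _; comp_auto.
Qed.

Lemma comp_filter (C X : countType) (f : C -> X -> bool) (l : C -> seq X) :
  computable (fun t => f t.1 t.2) -> computable l -> computable (fun c => filter (f c) (l c)).
Proof.
move=> Hf Hl.
apply: (@eq_computable _ _ (fun c => foldr (fun x s => if f c x then x :: s else s) [::] (l
    c))).
  by move=> c; elim: (l c) => //= x s ->.
apply: comp_foldr => //; last exact: comp_const.
by apply: comp_if; comp_auto; apply: comp_comp2 Hf _ _; comp_auto.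
Qed.

Lemma comp_has (C X : countType) (f : C -> X -> bool) (l : C -> seq X) :
  computable (fun t => f t.1 t.2) -> computable l -> computable (fun c => has (f c) (l c)).
Proof.
move=> Hf Hl.
apply: (@eq_computable _ _ (fun c => foldr (fun x b => f c x || b) false (l c))).
  by move=> c; elim: (l c) => //= x s ->.
apply: comp_foldr => //; last exact: comp_const.
by apply: comp_or; last comp_auto; apply: comp_comp2 Hf _ _; comp_auto.
Qed.

Lemma comp_all (C X : countType) (f : C -> X -> bool) (l : C -> seq X) :
  computable (fun t => f t.1 t.2) -> computable l -> computable (fun c => all (f c) (l c)).
Proof.
move=> Hf Hl.
apply: (@eq_computable _ _ (fun c => foldr (fun x b => f c x && b) true (l c))).
  by move=> c; elim: (l c) => //= x s ->.
apply: comp_foldr => //; last exact: comp_const.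
by apply: comp_and; last comp_auto; apply: comp_comp2 Hf _ _; comp_auto.
Qed.

Lemma comp_head (C X : countType) (z : C -> X) (l : C -> seq X) :
  computable z -> computable l -> computable (fun c => head (z c) (l c)).
Proof.
move=> Hz Hl; apply: (comp_seq_case (g := fun _ x _ => x)) => //.
by comp_auto.
Qed.

Lemma comp_nth (C X : countType) (z : C -> X) (l : C -> seq X) (n : C -> nat) :
  computable z -> computable l -> computable n -> computable (fun c => nth (z c) (l c) (n c)).
Proof.
move=> Hz Hl Hn.
apply: (@eq_computable _ _ (fun c => head (z c) (iter (n c) behead (l c)))).
  move=> c; elim: (n c) (l c) => [|k IH] [|x s] //=; rewrite -iterS iterSr /= IH //.
  by rewrite nth_nil.
apply: comp_head => //; apply: (comp_iter (g := fun _ => behead)) => //.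
by apply: comp_behead; comp_auto.
Qed.

Lemma comp_size (C X : countType) (l : C -> seq X) :
  computable l -> computable (fun c => size (l c)).
Proof.
move=> Hl; apply: (@eq_computable _ _ (fun c => foldr (fun _ => succn) 0 (l c))).
  by move=> c; elim: (l c) => //= x s ->.
by apply: (comp_foldr (g := fun _ _ => succn)) => //; comp_auto.
Qed.

Lemma comp_iota (C : countType) (n : C -> nat) :
  computable n -> computable (fun c => iota 0 (n c)).
Proof.
move=> Hn; apply: (@eq_computable _ _ (fun c => iter (n c) (fun s => rcons s (size s)) [::])).
  move=> c; have e k : iter k (fun s => rcons s (size s)) [::] = iota 0 k.
    elim: k => // k IH; rewrite iterS IH size_iota -[in RHS]addn1.
    by rewrite iotaD add0n cats1.
  exact: e.
apply: (comp_iter (g := fun _ s => rcons s (size s))) => //; last exact: comp_const.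
apply: (@eq_computable _ _ (fun t : C * seq nat => t.2 ++ [:: size t.2])).
  by move=> t; rewrite cats1.
by apply: comp_cat; comp_auto; apply: comp_size; comp_auto.
Qed.

Lemma comp_nseq (C X : countType) (n : C -> nat) (x : C -> X) :
  computable n -> computable x -> computable (fun c => nseq (n c) (x c)).
Proof.
move=> Hn Hx; apply: (@eq_computable _ _ (fun c => iter (n c) (cons (x c)) [::])) => //.
apply: (comp_iter (g := fun c s => x c :: s)) => //; last exact: comp_const.
by apply: comp_cons; comp_auto; apply: (comp_comp Hx); comp_auto.
Qed.

Definition prods (T : Type) (ls : seq (seq T)) : seq (seq T) :=
  foldr (fun l acc => flatten [seq [seq x :: y | y <- acc] | x <- l]) [:: [::]] ls.

Lemma comp_prods (C X : countType) (ls : C -> seq (seq X)) :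
  computable ls -> computable (fun c => prods (ls c)).
Proof.
move=> Hl; apply: (comp_foldr (g := fun _ (l : seq X) acc =>
  flatten [seq [seq x :: y | y <- acc] | x <- l])) => //; last exact: comp_const.
apply: comp_flatten; apply: comp_map; last by comp_auto.
by apply: comp_map; comp_auto.
Qed.

(** A sum is coded as a pair of options, and an option as a list with at most one element. So the
    head of the code is 0 exactly for [inr]. *)
Lemma pickle_inl (A B : countType) (x : A) :
  pickle (inl x : A + B) = ccons (ccons (pickle x) 0) (ccons 0 0).
Proof. by []. Qed.

Lemma pickle_inr (A B : countType) (x : B) :
  pickle (inr x : A + B) = ccons 0 (ccons (ccons (pickle x) 0) 0).
Proof. by []. Qed.

Lemma comp_inl (C A B : countType) (f : C -> A) :
  computable f -> computable (fun c => inl (f c) : A + B).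
Proof.
move=> Hf; have := comp_const C 0.
move=> H0; have H1 := comp_nat2 prn_ccons H0 H0.
have H2 := comp_nat2 prn_ccons (iffLR (comp_pickle _) Hf) H0.
exact: comp_recode (comp_nat2 prn_ccons H2 H1).
Qed.

Lemma comp_inr (C A B : countType) (f : C -> B) :
  computable f -> computable (fun c => inr (f c) : A + B).
Proof.
move=> Hf; have := comp_const C 0.
move=> H0; have H2 := comp_nat2 prn_ccons (iffLR (comp_pickle _) Hf) H0.
have H3 := comp_nat2 prn_ccons H2 H0.
exact: comp_recode (comp_nat2 prn_ccons H0 H3).
Qed.

Lemma comp_sum_case (C A B D : countType) (f : C -> A + B) (g : C -> A -> D) (h : C -> B -> D) :
  computable f -> computable (fun t => g t.1 t.2) -> computable (fun t => h t.1 t.2) ->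
  computable (fun c => match f c with inl a => g c a | inr b => h c b end).
Proof.
move=> Hf Hg Hh.
pose hd c := chead (pickle (f c)).
have Hhd : computable hd by apply: comp_nat1 prn_chead _; apply/comp_pickle.
(* Both branches repeat the match; each has to be computed only where the test has settled which
   case applies. *)
apply: (@eq_computable _ _ (fun c => if hd c == 0
    then match f c with inl a => g c a | inr b => h c b end
    else match f c with inl a => g c a | inr b => h c b end)).
  by move=> c; case: ifP.
have cpair_r (r : C -> nat) : computable r -> computable (fun c => ccons (pickle c) (ccons
    (r c) 0)).
  move=> Hr; have H1 := comp_nat2 prn_ccons Hr (comp_const C 0).
  exact: (comp_nat2 prn_ccons (iffLR (comp_pickle _) (comp_id C)) H1).
have hdE c : hd c = if f c is inl x then ccons (pickle x) 0 else 0.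
  by rewrite /hd; case: (f c) => x; rewrite ?pickle_inl ?pickle_inr chead_ccons.
have ccons0 x y : ccons x y == 0 = false.
  by apply/negbTE; rewrite -lt0n /ccons muln_gt0 expn_gt0.
apply: comp_if_lazy; first by comp_auto.
- apply: (computable_on_comp (r := fun c => ccons (pickle c)
    (ccons (chead (chead (ctail (pickle (f c))))) 0)) _ Hh).
    apply: cpair_r; do 2!apply: (comp_nat1 prn_chead).
    by apply: (comp_nat1 prn_ctail); apply/comp_pickle.
  move=> c; rewrite hdE; case: (f c) => x; first by rewrite ccons0.
  by move=> _; exists (c, x); rewrite // pickle_inr ctail_ccons !chead_ccons.
- apply: (computable_on_comp (r := fun c => ccons (pickle c) (ccons (chead (hd c)) 0)) _ Hg).
    by apply: cpair_r; apply: (comp_nat1 prn_chead).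
  move=> c; rewrite hdE; case: (f c) => x //.
  by move=> _; exists (c, x); rewrite // chead_ccons.
Qed.

Lemma comp_nat_case (C A : countType) (n : C -> nat) (z : C -> A) (g : C -> nat -> A) :
  computable n -> computable z -> computable (fun t => g t.1 t.2) ->
  computable (fun c => if n c is m.+1 then g c m else z c).
Proof.
move=> Hn Hz Hg.
apply: (@eq_computable _ _ (fun c => if n c == 0 then z c else g c (n c).-1)).
  by move=> c; case: (n c).
apply: comp_if => //; first by comp_auto.
by apply: (comp_comp2 Hg); comp_auto; apply: comp_pred.
Qed.

(** * Folds over trees, computed on their token sequences *)

Section Fold.
Variables (T V : Type) (leaf : T -> V) (node : nat -> seq V -> V).

Fixpoint gfold (t : GenTree.tree T) : V :=
  match t with
  | GenTree.Leaf x => leaf x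
  | GenTree.Node n ts => node n (map gfold ts)
  end.

(** A stack machine reading the encoding from right to left. The token [inl 0] closes a node, so it
    opens a fresh list of children and saves the current one; [inl n.+1] ends that list and puts the
    value of the node in front of the saved one. *)
Definition gstep (c : nat + T) (fs : seq V * seq (seq V)) : seq V * seq (seq V) :=
  match c with
  | inr x => (leaf x :: fs.1, fs.2)
  | inl k => if k is n.+1 then (node n fs.1 :: head [::] fs.2, behead fs.2)
             else ([::], fs.1 :: fs.2)
  end.

Lemma gstep_encode t fs : foldr gstep fs (GenTree.encode t) = (gfold t :: fs.1, fs.2).
Proof.
elim: t fs => //= n ts IHt fs; rewrite foldr_rcons /=.
have -> : foldr gstep ([::], fs.1 :: fs.2) (flatten (map (@GenTree.encode T) ts))
    = (map gfold ts, fs.1 :: fs.2) => //.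
elim: ts IHt => //= t ts IH [IHt /IH IHts].
by rewrite foldr_cat IHts IHt.
Qed.

End Fold.

Lemma comp_gstep (C T V : countType) (leaf : C -> T -> V) (node : C -> nat -> seq V -> V) :
  computable (fun t => leaf t.1 t.2) -> computable (fun t => node t.1 t.2.1 t.2.2) ->
  computable (fun t : C * ((nat + T) * (seq V * seq (seq V))) =>
          gstep (leaf t.1) (node t.1) t.2.1 t.2.2).
Proof.
move=> Hl Hn; rewrite /gstep.
apply: (comp_sum_case (f := fun t : C * ((nat + T) * (seq V * seq (seq V))) => t.2.1)).
- by comp_auto.
- apply: (comp_nat_case
    (n := fun t : C * ((nat + T) * (seq V * seq (seq V))) * nat => t.2)
    (g := fun t n => (node t.1.1 n t.1.2.2.1 :: head [::] t.1.2.2.2, behead t.1.2.2.2))).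
  + by comp_auto.
  + by comp_auto.
  + apply: comp_pair; last by apply: comp_behead; comp_auto.
    apply: comp_cons; last by apply: comp_head; comp_auto.
    by apply: (comp_comp3 Hn); comp_auto.
- apply: comp_pair; last by comp_auto.
  by apply: comp_cons; first apply: (comp_comp2 Hl); comp_auto.
Qed.

Lemma comp_gfold (C T V : countType) (leaf : C -> T -> V) (node : C -> nat -> seq V -> V)
    (f : C -> GenTree.tree T) :
  computable (fun t => leaf t.1 t.2) ->
  computable (fun t => node t.1 t.2.1 t.2.2) -> computable f ->
  computable (fun c => gfold (leaf c) (node c) (f c)).
Proof.
move=> Hl Hn Hf.
pose w c := foldr (gstep (leaf c) (node c)) ([::], [::]) (GenTree.encode (f c)).
apply: (@comp_code_head _ _ (fun c => pickle (w c).1)).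
  by move=> c; rewrite /w gstep_encode /= pickle_cons chead_ccons.
apply/comp_pickle; apply: comp_fst.
apply: (comp_foldr (g := fun c => gstep (leaf c) (node c))).
- exact: comp_gstep.
- exact: comp_const.
- exact: comp_recode Hf.
Qed.

Lemma pickle_tree (T : countType) (t : GenTree.tree T) :
  pickle t = pickle (GenTree.encode t).
Proof. by []. Qed.

Lemma comp_Leaf (C T : countType) (f : C -> T) :
  computable f -> computable (fun c => GenTree.Leaf (f c)).
Proof.
move=> Hf; apply: (@comp_recode _ _ _ (fun c => [:: inr (f c) : nat + T])).
  by move=> c; rewrite pickle_tree.
by apply: comp_cons; last exact: comp_const; apply: comp_inr.
Qed.

Lemma comp_Node (C T : countType) (n : C -> nat) (f : C -> seq (GenTree.tree T)) :
  computable n -> computable f -> computable (fun c => GenTree.Node (n c) (f c)).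
Proof.
move=> Hn Hf.
apply: (@comp_recode _ _ _ (fun c => (inl (n c).+1 :: (flatten
  (map (@GenTree.encode T) (f c)) ++ [:: inl 0])) : seq (nat + T))).
  by move=> c; rewrite pickle_tree [GenTree.encode _]/= cats1.
apply: comp_cons; first by apply: comp_inl; comp_auto.
apply: comp_cat; last exact: comp_const.
apply: comp_flatten; apply: comp_recode Hf => c.
by rewrite -![RHS]/(CodeSeq.code _) -map_comp.
Qed.

(* Computable surjections from [nat]: the programs searching over all values
   of a type run through all natural numbers. *)
Definition enumerable (A : countType) : Prop :=
  exists2 f : nat -> A, computable f & forall a, exists n, f n = a.

Lemma enum_nat : enumerable nat.
Proof. by exists id; [apply: comp_id | move=> a; exists a]. Qed.

(** [CodeSeq.code] is a bijection between lists of numbers and numbers, so decoding does not change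
    the code and the identity program computes it. *)
Lemma comp_decode : computable CodeSeq.decode.
Proof.
apply: comp_recode (comp_id _) => n; rewrite -[LHS](CodeSeq.decodeK n).
by rewrite -[RHS]/(CodeSeq.code (map _ _)) map_id.
Qed.

Lemma enum_seq (A : countType) : enumerable A -> enumerable (seq A).
Proof.
move=> [f Hf sf]; exists (fun n => map f (CodeSeq.decode n)).
  by apply: (comp_map (f := fun _ => f)) comp_decode; apply: (comp_comp Hf); comp_auto.
move=> s; suff [l <-] : exists l, map f l = s by exists (CodeSeq.code l); rewrite CodeSeq.codeK.
elim: s => [|x s [l <-]]; first by exists [::].
by have [n <-] := sf x; exists (n :: l).
Qed.

Lemma enum_prod (A B : countType) : enumerable A -> enumerable B ->
  enumerable (A * B)%type.
Proof.
move=> [f Hf sf] [g Hg sg].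
exists (fun n => (f (nth 0 (CodeSeq.decode n) 0), g (nth 0 (CodeSeq.decode n) 1))).
  apply: comp_pair; [apply: (comp_comp Hf) | apply: (comp_comp Hg)];
  by apply: comp_nth; [exact: comp_const | exact: comp_decode | exact: comp_const].
move=> [a b]; have [n <-] := sf a; have [m <-] := sg b.
by exists (CodeSeq.code [:: n; m]); rewrite CodeSeq.codeK.
Qed.

(** Arbitrary token sequences are run through the stack machine; malformed ones yield some tree or
    the default leaf, and encodings yield the encoded tree. A token is enumerated as a flag together
    with both possible contents. *)
Lemma enum_tree (A : countType) : enumerable A -> A -> enumerable (GenTree.tree A).
Proof.
move=> enA a0; have [g Hg sg] : enumerable (seq (bool * (nat * A))).
  apply/enum_seq/enum_prod; last exact/enum_prod/enA/enum_nat.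
  exists (fun n => n == 0); first by comp_auto.
  by case; [exists 0 | exists 1].
pose tok (x : bool * (nat * A)) : nat + A := if x.1 then inl x.2.1 else inr x.2.2.
exists (fun n => head (GenTree.Leaf a0)
   (foldr (gstep (@GenTree.Leaf A) (@GenTree.Node A)) ([::], [::]) (map tok (g n))).1).
  apply: comp_head; first exact: comp_const; apply: comp_fst.
  apply: (comp_foldr (g := fun _ => gstep (@GenTree.Leaf A) (@GenTree.Node A))).
  - apply: (comp_gstep (leaf := fun _ => @GenTree.Leaf A) (node := fun _ => @GenTree.Node A)).
      by apply: comp_Leaf; comp_auto.
    by apply: comp_Node; comp_auto.
  - exact: comp_const.
  - apply: (comp_map (f := fun _ => tok)) => //; apply: comp_if; first by comp_auto.
      by apply: comp_inl; comp_auto.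
    by apply: comp_inr; comp_auto.
move=> t; pose untok (c : nat + A) := match c with
  inl n => (true, (n, a0)) | inr a => (false, (0, a)) end.
have [n en] := sg (map untok (GenTree.encode t)); exists n.
have -> : map tok (g n) = GenTree.encode t.
  by rewrite en -map_comp; apply: map_id_in => -[].
rewrite gstep_encode /=.
elim: t {en} => //= k ts IH; congr GenTree.Node.
by elim: ts IH => //= t ts IHs [-> /IHs ->].
Qed.

(** * Runs and tables *)

Lemma Forall2_nth (X Y : Type) (P : X -> Y -> Prop) (xs : seq X) (ys : seq Y) x0 y0 :
  Forall2 P xs ys -> P x0 y0 -> forall i, P (nth x0 xs i) (nth y0 ys i).
Proof. by move=> H P0; elim: H => [|x y ? ? Pxy _ IH] [|i] /=. Qed.

Lemma Forall2_size (X Y : Type) (P : X -> Y -> Prop) (xs : seq X) (ys : seq Y) :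
  Forall2 P xs ys -> size xs = size ys.
Proof. by elim=> //= ? ? ? ? _ _ ->. Qed.

Lemma prodsP (T : eqType) (xs : seq T) (ls : seq (seq T)) :
  xs \in prods ls <-> Forall2 (fun x (l : seq T) => x \in l) xs ls.
Proof.
elim: ls xs => [|l ls IH] xs /=.
  rewrite inE; split; first by move/eqP->; constructor.
  by inversion 1.
split.
  case/flattenP => ? /mapP[x xl ->] /mapP[y /IH Hy ->]; by constructor.
inversion 1 as [|x l' ys ls' xl Hys]; subst; move/IH: Hys => Hys.
by apply/flattenP; exists [seq x :: y | y <- prods ls]; apply: map_f.
Qed.

Lemma gtree_ind (T : eqType) (P : GenTree.tree T -> Prop) :
  (forall x, P (GenTree.Leaf x)) ->
  (forall n ts, {in ts, forall t, P t} -> P (GenTree.Node n ts)) -> forall t, P t.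
Proof.
move=> PL PN; elim=> // n ts IH; apply: PN; elim: ts IH => //= t ts IHts [Pt /IHts Pts] u.
by rewrite inE => /orP[/eqP->|/Pts].
Qed.

Section SetFold.
Variables (V : eqType) (leaf : nat * nat -> seq V) (nd : nat -> seq V -> V).

(** Each occurrence of a leaf picks its value independently, as nondeterministic rewriting does. *)
Definition choices : rhs -> seq V :=
  gfold leaf (fun n vs => [seq nd n us | us <- prods vs]).

Lemma choices_Node n rs :
  choices (GenTree.Node n rs) = [seq nd n us | us <- prods (map choices rs)].
Proof. by []. Qed.

(* [inst_rel f r t]: [t] is [r] with every leaf [x] replaced by some tree
   related to [x] by [f], independently for each occurrence. *)
Fixpoint inst_rel (f : nat * nat -> tree -> Prop) (r : rhs) : tree -> Prop :=
  match r with
  | GenTree.Leaf x => f x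
  | GenTree.Node b cs => fun t =>
      exists2 ts, t = Nd b ts & Forall2 (fun P u => P u) (map (inst_rel f) cs) ts
  end.

Variables (B : V -> tree -> Prop) (f : nat * nat -> tree -> Prop).
Hypothesis ndB : forall n vs ts, Forall2 B vs ts -> B (nd n vs) (Nd n ts).

(** Abstract interpretation: [B] relates abstract values to trees and is compatible with nodes, so
    it passes from leaves to whole right-hand sides; [choices_realized] is the other direction.
    Ground results, symbolic terms and bare domains are all instances. *)
Lemma choices_covers r t :
  (forall x t, f x t -> exists2 v, v \in leaf x & B v t) ->
  inst_rel f r t -> exists2 v, v \in choices r & B v t.
Proof.
move=> Hf; elim/gtree_ind: r t => [x|n rs IH] t /=; first exact: Hf.
case=> ts -> Hts.
have [vs vsP vsB] : exists2 vs, vs \in prods (map choices rs) & Forall2 B vs ts.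
  elim: rs ts Hts IH => [|r rs IHrs] ts Hts IH.
    by inversion Hts; exists [::]; rewrite ?mem_seq1.
  inversion Hts as [|P u Ps us Hu Hus]; subst.
  have [v vr vu] := IH r (mem_head _ _) _ Hu.
  have [|vs /prodsP vsP vsB] := IHrs _ Hus.
    by move=> r' r'rs; apply: IH; rewrite inE r'rs orbT.
  by exists (v :: vs); [apply/prodsP; rewrite [map _ _]/=; constructor | constructor].
by exists (nd n vs); [apply: map_f | apply: ndB].
Qed.

Lemma choices_realized r v :
  (forall x v, v \in leaf x -> exists2 t, f x t & B v t) ->
  v \in choices r -> exists2 t, inst_rel f r t & B v t.
Proof.
move=> Hf; elim/gtree_ind: r v => [x|n rs IH] v; first exact: Hf.
rewrite choices_Node; case/mapP => vs /prodsP vsP ->.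
have [ts Hts tsB] : exists2 ts,
    Forall2 (fun P u => P u) (map (inst_rel f) rs) ts & Forall2 B vs ts.
  elim: rs vs vsP IH => [|r rs IHrs] vs vsP IH.
    by inversion vsP; exists [::]; constructor.
  inversion vsP as [|w l ws ls wl Hws]; subst.
  have [u ur uw] := IH r (mem_head _ _) _ wl.
  have [|us usP usB] := IHrs _ Hws.
    by move=> r' r'rs; apply: IH; rewrite inE r'rs orbT.
  by exists (u :: us); constructor.
by exists (Nd n ts); [exists ts | apply: ndB].
Qed.

End SetFold.

Lemma prods_map (X Y : Type) (h : X -> Y) ls :
  prods (map (map h) ls) = map (map h) (prods ls).
Proof.
elim: ls => //= l ls ->; rewrite map_flatten -!map_comp; congr flatten.
by apply: eq_map => x /=; rewrite -!map_comp.
Qed.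

Lemma choices_map (V W : eqType) (h : V -> W) leaf leaf' nd nd' r :
  (forall x, leaf' x = map h (leaf x)) ->
  (forall n vs, h (nd n vs) = nd' n (map h vs)) ->
  choices leaf' nd' r = map h (choices leaf nd r).
Proof.
move=> Hl Hn; elim/gtree_ind: r => [x|n rs IH] //=.
have -> : map (gfold leaf' (fun n vs => [seq nd' n us | us <- prods vs])) rs =
    map (map h) (map (choices leaf nd) rs).
  by rewrite -map_comp; apply/eq_in_map.
by rewrite prods_map -!map_comp; apply: eq_map => us /=; rewrite Hn.
Qed.

Definition rules := seq (nat * nat * rhs).

(** A big-step semantics by recursion on the input; a variable out of range has no output.
    [trel_run] relates it to rewriting. *)
Fixpoint run (R : rules) (s : tree) : nat -> tree -> Prop :=
  match s with
  | Nd a ss => fun q t => exists2 r, (q, a, r) \in R &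
      inst_rel (fun x => nth (fun _ _ => False) (map (run R) ss) x.2 x.1) r t
  end.

Notation table V := (seq (nat * V)).

Definition lookup (V : Type) (q : nat) (I : table V) : seq V :=
  [seq e.2 | e <- I & e.1 == q].

Lemma mem_lookup (V : eqType) q (I : table V) v : (v \in lookup q I) = ((q, v) \in I).
Proof.
apply/mapP/idP => [[[p w]] | qvI]; last by exists (q, v); rewrite // mem_filter eqxx.
by rewrite mem_filter => /andP[/eqP/= <- pwI ->].
Qed.

(* One rule application at a node [a], from the tables [Is] of its subtrees;
   used for [T2] with terms as values and for [T1] with tables of [T2] as
   values. *)
Definition fire (V : eqType) (nd : nat -> seq V -> V) (R : rules) (a : nat)
    (Is : seq (table V)) : table V :=
  flatten [seq [seq (rl.1.1, v) | v <-
                 choices (fun x => lookup x.1 (nth [::] Is x.2)) nd rl.2]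
          | rl <- R & rl.1.2 == a].

Definition lmap (V W : Type) (h : V -> W) (I : table V) : table W :=
  [seq (e.1, h e.2) | e <- I].

Lemma lookup_lmap (V W : Type) (h : V -> W) q I :
  lookup q (lmap h I) = map h (lookup q I).
Proof. by rewrite /lookup filter_map -!map_comp. Qed.

(** Naturality: rules inspect the states of a table but never the values. *)
Lemma fire_lmap (V W : eqType) (h : V -> W) nd nd' R a Is :
  (forall n vs, h (nd n vs) = nd' n (map h vs)) ->
  lmap h (fire nd R a Is) = fire nd' R a (map (lmap h) Is).
Proof.
move=> Hn; rewrite /fire /lmap map_flatten -map_comp; congr flatten.
apply: eq_map => -[[q b] r] /=; rewrite -map_comp.
rewrite (@choices_map _ _ h (fun x => lookup x.1 (nth [::] Is x.2)) _ nd nd') //.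
  by rewrite -map_comp.
move=> x; rewrite -lookup_lmap; congr lookup.
by elim: Is x.2 => [|I Is IH] [|i] /=.
Qed.

(** Meant to be nested: for [T1] the values are tables, and [B] is then itself a relation of this
    kind between a table and the runs of [T2] on an intermediate tree. *)
Definition covers (V : eqType) (B : V -> tree -> Prop) (I : table V)
    (F : nat -> tree -> Prop) : Prop :=
  forall q t, F q t -> exists2 v, (q, v) \in I & B v t.

Definition realized (V : eqType) (B : V -> tree -> Prop) (I : table V)
    (F : nat -> tree -> Prop) : Prop :=
  forall q v, (q, v) \in I -> exists2 t, F q t & B v t.

Section Fire.
Variables (V : eqType) (nd : nat -> seq V -> V) (B : V -> tree -> Prop).
Hypothesis ndB : forall n vs ts, Forall2 B vs ts -> B (nd n vs) (Nd n ts).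
Variables (R : rules) (a : nat).

Lemma mem_fire Is q v : (q, v) \in fire nd R a Is <-> exists2 r, (q, a, r) \in R &
  v \in choices (fun x => lookup x.1 (nth [::] Is x.2)) nd r.
Proof.
split.
  case/flattenP => ? /mapP[[[q' a'] r]]; rewrite mem_filter => /andP[/eqP/= -> rR] ->.
  by case/mapP => w wv [-> ->]; exists r.
move=> [r rR vr]; apply/flattenP.
exists [seq (q, v) | v <- choices (fun x => lookup x.1 (nth [::] Is x.2)) nd r].
  by apply/mapP; exists (q, a, r); rewrite // mem_filter eqxx.
exact: map_f.
Qed.

Lemma fire_covers Is ss : Forall2 (fun I s => covers B I (run R s)) Is ss ->
  covers B (fire nd R a Is) (run R (Nd a ss)).
Proof.
move=> H q t [r rR Hr].
have HF : Forall2 (fun I F => covers B I F) Is (map (run R) ss).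
  by elim: H => /= *; constructor.
have [|v vr vB] := choices_covers (leaf := fun x => lookup x.1 (nth [::] Is x.2)) ndB _ Hr.
  move=> x u Hu.
  have F0 : covers B [::] (fun _ _ => False) by move=> ? ? [].
  by have [v] := Forall2_nth HF F0 x.2 _ _ Hu; rewrite -mem_lookup; exists v.
by exists v => //; apply/mem_fire; exists r.
Qed.

Lemma fire_realized Is ss : Forall2 (fun I s => realized B I (run R s)) Is ss ->
  realized B (fire nd R a Is) (run R (Nd a ss)).
Proof.
move=> H q v /mem_fire[r rR vr].
have HF : Forall2 (fun I F => realized B I F) Is (map (run R) ss).
  by elim: H => /= *; constructor.
have [|t Ht vB] := choices_realized (f := fun x =>
    nth (fun _ _ => False) (map (run R) ss) x.2 x.1) ndB _ vr.
  move=> x u; rewrite mem_lookup.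
  have F0 : realized B [::] (fun _ _ => False) by [].
  exact: (Forall2_nth HF F0).
by exists t => //; exists r.
Qed.

End Fire.

(** * Symbolic items and certificates *)

Notation term := (GenTree.tree nat).
Notation Var := (@GenTree.Leaf nat).
Notation App := (@GenTree.Node nat).

Definition eval (v : nat -> tree) : term -> tree := gfold v Nd.
Definition tsubst (s : nat -> term) : term -> term := gfold s App.
Definition vars : term -> seq nat := gfold (fun x => [:: x]) (fun _ vs => flatten vs).

Lemma mem_vars_App n ts x : (x \in vars (App n ts)) = has (fun t => x \in vars t) ts.
Proof.
apply/flattenP/hasP => [[? /mapP[t tts ->]]|[t tts xt]]; first by exists t.
by exists (vars t) => //; apply: map_f.
Qed.

Lemma gfold_tsubst (V : Type) (l : nat -> V) nd s t :
  gfold l nd (tsubst s t) = gfold (fun x => gfold l nd (s x)) nd t.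
Proof.
elim/gtree_ind: t => //= n ts IH; congr nd.
by rewrite -map_comp; apply/eq_in_map.
Qed.

Lemma eq_in_gfold (V : Type) (l l' : nat -> V) nd t :
  {in vars t, l =1 l'} -> gfold l nd t = gfold l' nd t.
Proof.
elim/gtree_ind: t => [x H|n ts IH H] /=; first by apply: H; rewrite mem_seq1.
congr nd; apply/eq_in_map => t tts; apply: IH => // x xt; apply: H.
by rewrite mem_vars_App; apply/hasP; exists t.
Qed.

Lemma tsubst_id t : tsubst Var t = t.
Proof.
by elim/gtree_ind: t => //= n ts IH; congr App; rewrite -[RHS]map_id; apply/eq_in_map.
Qed.

Lemma vars_tsubst s t y : reflect (exists2 x, x \in vars t & y \in vars (s x))
  (y \in vars (tsubst s t)).
Proof.
apply: (iffP idP); elim/gtree_ind: t => [x|n ts IH].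
- by exists x; rewrite ?mem_seq1.
- rewrite mem_vars_App has_map => /hasP[t tts /(IH _ tts)[x xt yx]].
  by exists x => //; rewrite mem_vars_App; apply/hasP; exists t.
- by case=> z; rewrite mem_seq1 => /eqP->.
- case=> x; rewrite !mem_vars_App has_map => /hasP[t tts xt] yx.
  by apply/hasP; exists t => //; apply: IH => //; exists x.
Qed.

Lemma eval_inj v w t : eval v t = eval w t -> {in vars t, v =1 w}.
Proof.
elim/gtree_ind: t => [x e y|n ts IH [e] x]; first by rewrite mem_seq1 => /eqP->.
rewrite mem_vars_App => /hasP[t tts]; apply: IH => //.
by have /eq_in_map/(_ t tts) := e.
Qed.

(* The variable 0 stands for an unknown result. *)
Definition unk (t : term) : bool := has (eq_op^~ 0) (vars t).

Lemma unkE t : unk t = (0 \in vars t).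
Proof. by rewrite /unk has_pred1. Qed.

(** The nesting keeps together the results of all [T2]-states on one output of [T1]: when [T2]
    copies a subtree, the copies are the same tree. *)
Notation beh := (table term).
Notation item := (table beh).

Definition beh_map (s : nat -> term) : beh -> beh := lmap (tsubst s).
Definition item_map (s : nat -> term) : item -> item := lmap (beh_map s).

Lemma mem_lmap (V W : eqType) (h : V -> W) q w (I : table V) :
  (q, w) \in lmap h I <-> exists2 v, (q, v) \in I & w = h v.
Proof.
split; first by case/mapP => -[p v] pvI [-> ->]; exists v.
by case=> v qvI ->; apply/mapP; exists (q, v).
Qed.

(** A right-hand side of [T1] is evaluated node by node, a step of [T2] being the operation at each
    node. *)
Definition trans (R1 R2 : rules) (a : nat) (Is : seq item) : item :=
  fire (fire App R2) R1 a Is.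

(** Naturality at both levels: a step on instances of symbolic items is the instance of the symbolic
    step. *)
Lemma trans_item_map R1 R2 a s Is :
  item_map s (trans R1 R2 a Is) = trans R1 R2 a (map (item_map s) Is).
Proof. by apply: fire_lmap => n bs; apply: fire_lmap. Qed.

(** An unknown entry covers every result, and one unknown leaf makes the whole term unknown. *)
Definition beh_covers R2 v (b : beh) (t : tree) : Prop :=
  covers (fun x u => unk x \/ eval v x = u) b (run R2 t).

Definition beh_realized R2 v (b : beh) (t : tree) : Prop :=
  realized (fun x u => eval v x = u) b (run R2 t).

Lemma unk_App n ts : unk (App n ts) = has unk ts.
Proof. by rewrite unkE mem_vars_App; apply: eq_has => t; rewrite unkE. Qed.

Lemma fire_beh_covers R2 v b bs ts : Forall2 (beh_covers R2 v) bs ts ->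
  beh_covers R2 v (fire App R2 b bs) (Nd b ts).
Proof.
apply: fire_covers => n xs us H; rewrite unk_App.
suff [->|<-] : has unk xs \/ map (eval v) xs = us by [left | right].
elim: H => [|x u xs' us' xu _ IH] /=; first by right.
by case: xu IH => [->|<-] [->|<-]; rewrite ?orbT; auto.
Qed.

Lemma fire_beh_realized R2 v b bs ts : Forall2 (beh_realized R2 v) bs ts ->
  beh_realized R2 v (fire App R2 b bs) (Nd b ts).
Proof.
apply: fire_realized => n xs us H; congr Nd.
by elim: H => //= x u xs' us' <- _ <-.
Qed.

(* Keeps the variables of the [i]-th item apart from those of the others. *)
Definition mark (i x : nat) : nat := if x is y.+1 then (pickle (i, y)).+1 else 0.
Definition unmark (x : nat) : nat * nat :=
  if x is y.+1 then if unpickle y is Some (i, z) then (i, z.+1) else (0, 0) else (0, 0).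

Lemma markK i x : 0 < x -> unmark (mark i x) = (i, x).
Proof. by case: x => // x _; rewrite /mark /unmark pickleK. Qed.

Lemma mark_eq0 i x : (mark i x == 0) = (x == 0).
Proof. by case: x. Qed.

Definition rename (Is : seq item) : seq item :=
  mkseq (fun i => item_map (fun x => Var (mark i x)) (nth [::] Is i)) (size Is).

Definition merge_val (T : Type) (vs : nat -> nat -> T) (y : nat) : T :=
  vs (unmark y).1 (unmark y).2.

Lemma unk_ren i t : unk (tsubst (fun x => Var (mark i x)) t) = unk t.
Proof.
rewrite !unkE; apply/vars_tsubst/idP => [[x xt]|t0].
  by rewrite mem_seq1 eq_sym mark_eq0 => /eqP<-.
by exists 0.
Qed.

Lemma eval_ren vs i t : ~~ unk t ->
  eval (merge_val vs) (tsubst (fun x => Var (mark i x)) t) = eval (vs i) t.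
Proof.
move=> t0; rewrite /eval gfold_tsubst; apply: eq_in_gfold => x xt /=.
rewrite /merge_val markK //; case: x xt => // xt.
by move: t0; rewrite unkE xt.
Qed.

Lemma Forall2_of_nth (X Y : Type) (P : X -> Y -> Prop) xs ys x0 y0 :
  size xs = size ys -> (forall i, i < size ys -> P (nth x0 xs i) (nth y0 ys i)) ->
  Forall2 P xs ys.
Proof.
elim: ys xs => [|y ys IH] [|x xs] //= [sz] H; constructor; first exact: (H 0).
by apply: IH => // i; apply: (H i.+1).
Qed.

Lemma covers_rename R2 vs i I F :
  covers (beh_covers R2 (vs i)) I F ->
  covers (beh_covers R2 (merge_val vs)) (item_map (fun x => Var (mark i x)) I) F.
Proof.
move=> H q t /H[b bI Hb]; exists (beh_map (fun x => Var (mark i x)) b).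
  by apply/mem_lmap; exists b.
move=> p u /Hb[x xb xu]; exists (tsubst (fun x => Var (mark i x)) x).
  by apply/mem_lmap; exists x.
rewrite unk_ren; case: xu => [->|<-]; first by left.
by case: (boolP (unk x)) => [|ux]; [left | right; apply: eval_ren].
Qed.

(** One substitution serves the whole item, so that a valuation for [I] composed with [s] is a
    valuation for [J]. Entries of [J] may forget, but never gain, information. *)
Definition covered (I J : item) (s : nat -> term) : bool :=
  all (fun e => has (fun e' => (e.1 == e'.1) &&
    all (fun x => has (fun x' => (x.1 == x'.1) &&
       (unk x'.2 || (~~ unk x.2 && (x.2 == tsubst s x'.2)))) e'.2) e.2) J) I.

Lemma covered_covers R2 v s I J F : covered I J s ->
  covers (beh_covers R2 v) I F ->
  covers (beh_covers R2 (fun x => eval v (s x))) J F.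
Proof.
move=> /allP cIJ HI q t /HI[b bI Hb].
have /hasP[[q' b'] bJ /andP[/eqP/= eq /allP Hbb]] := cIJ _ bI; subst q'.
exists b' => // p u /Hb[x xb xu].
have /hasP[[p' x'] xb' /andP[/eqP/= ep Hx]] := Hbb _ xb; subst p'.
exists x' => //; case/orP: Hx => [->|/andP[ux /eqP ex]]; first by left.
by case: xu => [|<-]; [rewrite (negbTE ux) | right; rewrite ex /eval gfold_tsubst].
Qed.

(* The second component is a pool of substitutions, as lists of images. *)
Definition cert := (seq item * seq (seq term))%type.

(** There is no separate base case: a symbol of rank 0 has the empty list as its only list of
    arguments. *)
Definition closed_cert (S : ralph) (R1 R2 : rules) (c : cert) : bool :=
  all (fun ak => all (fun Is => has (fun J => has (fun s =>
      covered (trans R1 R2 ak.1 (rename Is)) J (nth (Var 0) s)) c.2) c.1)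
    (prods (nseq ak.2 c.1))) S.

Definition finals (q0 p0 : nat) (I : item) : seq term :=
  flatten [seq lookup p0 b | b <- lookup q0 I].

Lemma mem_finals q0 p0 I x :
  x \in finals q0 p0 I <-> exists2 b, (q0, b) \in I & (p0, x) \in b.
Proof.
split; first by case/flattenP => ? /mapP[b]; rewrite mem_lookup => bI ->; rewrite mem_lookup;
  exists b.
case=> b bI xb; apply/flattenP; exists (lookup p0 b); last by rewrite mem_lookup.
by apply: map_f; rewrite mem_lookup.
Qed.

Definition final_cert (q0 p0 : nat) (c : cert) : bool :=
  all (fun I => all (fun x => ~~ unk x && all (fun y => y == x) (finals q0 p0 I))
                    (finals q0 p0 I)) c.1.

Lemma prods_nseqP (T : eqType) k (l xs : seq T) :
  xs \in prods (nseq k l) <-> size xs = k /\ {subset xs <= l}.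
Proof.
split=> [/prodsP H | [<- {k} sub]].
  split; first by rewrite (Forall2_size H) size_nseq.
  elim: k xs H => [|k IH] xs H; inversion H as [|x ? xs' ? xl Hxs]; subst => //.
  by move=> y; rewrite inE => /orP[/eqP->|]; last exact: IH.
apply/prodsP; elim: xs sub => //= x xs IH sub.
constructor; first by apply: sub; rewrite inE eqxx.
by apply: IH => y yxs; apply: sub; rewrite inE yxs orbT.
Qed.

Lemma tree_Forall_ind (P : tree -> Prop) :
  (forall a ts, Forall P ts -> P (Nd a ts)) -> forall t, P t.
Proof.
move=> H; fix IH 1 => -[a ts]; apply: H.
by elim: ts => [|t ts IHts]; constructor.
Qed.

Lemma in_T_Nd S a ts : in_T S (Nd a ts) <-> (a, size ts) \in S /\ Forall (in_T S) ts.
Proof. by split => [H|[]]; [inversion H | constructor]. Qed.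

(** Induction on the input: the valuations obtained for the subtrees are merged along [mark] and
    composed with the substitution that closedness provides. *)
Lemma closed_cert_covers S R1 R2 c s : closed_cert S R1 R2 c -> in_T S s ->
  exists2 I, I \in c.1 & exists v, covers (beh_covers R2 v) I (run R1 s).
Proof.
move=> /allP cc; elim/tree_Forall_ind: s => a ss IH /in_T_Nd[aS Hss].
have [L HL] : exists L : seq (item * (nat -> tree)),
    Forall2 (fun Iv s => Iv.1 \in c.1 /\ covers (beh_covers R2 Iv.2) Iv.1 (run R1 s)) L ss.
  elim: Hss IH {aS} => [|s ss' sS _ IHss] IH; first by exists [::].
  inversion IH as [|? ? Hs Hss']; subst.
  have [I Ic [v Hv]] := Hs sS; have [L HL] := IHss Hss'.
  by exists ((I, v) :: L); constructor.
have sL := Forall2_size HL.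
have Lprods : map fst L \in prods (nseq (size ss) c.1).
  by apply/prodsP; elim: HL => //= Iv s L' ss' [? _] _ IHL; constructor.
have /allP/(_ _ Lprods)/hasP[J Jc /hasP[s sc Hcov]] := cc _ aS.
exists J => //; exists (fun x => eval (merge_val (fun i => (nth ([::], fun=> Nd 0 [::]) L
    i).2)) (nth (Var 0) s x)).
apply: covered_covers Hcov _; apply: fire_covers; first exact: fire_beh_covers.
apply: (Forall2_of_nth (x0 := [::]) (y0 := Nd 0 [::])); first by rewrite size_mkseq size_map.
move=> i; rewrite -sL => iL; rewrite nth_mkseq ?size_map //.
set vs := fun i : nat => _; apply: (@covers_rename R2 vs i).
elim: HL i iL @vs {Lprods Hss IH sL aS} => [|Iv s' L' ss' [_ H] _ IHL] [|i] //=; exact: IHL.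
Qed.

Definition composed R1 R2 q0 p0 (s u : tree) : Prop :=
  exists2 t, run R1 s q0 t & run R2 t p0 u.

Definition unique_on S R1 R2 q0 p0 : Prop := forall s, in_T S s ->
  forall u u', composed R1 R2 q0 p0 s u -> composed R1 R2 q0 p0 s u' -> u = u'.

(** Both results are values, under the same valuation, of final terms that are known and
    syntactically equal. *)
Lemma cert_sound S R1 R2 q0 p0 c :
  closed_cert S R1 R2 c -> final_cert q0 p0 c -> unique_on S R1 R2 q0 p0.
Proof.
move=> cc /allP fc s sS u u' [t Ht Hu] [t' Ht' Hu'].
have [I /fc/allP fI [v HI]] := closed_cert_covers cc sS.
have fin u1 t1 : run R1 s q0 t1 -> run R2 t1 p0 u1 ->
    exists2 x, x \in finals q0 p0 I & eval v x = u1.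
  move=> /HI[b bI Hb] /Hb[x xb xu].
  have xI : x \in finals q0 p0 I by apply/mem_finals; exists b.
  by exists x => //; have /andP[ux _] := fI _ xI; case: xu => //; rewrite (negbTE ux).
have [x xI <-] := fin _ _ Ht Hu; have [y yI <-] := fin _ _ Ht' Hu'.
by have /andP[_ /allP/(_ _ yI)/eqP->] := fI _ xI.
Qed.

(** * Items of actual inputs and the search for conflicts *)

(** The items of trees of height at most [n], where a single leaf has height 1. *)
Definition level (S : ralph) (R1 R2 : rules) (n : nat) : seq item :=
  iter n (fun E => flatten [seq [seq trans R1 R2 ak.1 Is | Is <- prods (nseq ak.2 E)]
                           | ak <- S]) [::].

Definition conflict (q0 p0 : nat) (I : item) : bool :=
  has (fun x => has (fun y => x != y) (finals q0 p0 I)) (finals q0 p0 I).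

Fixpoint item_of (R1 R2 : rules) (s : tree) : item :=
  match s with Nd a ss => trans R1 R2 a (map (item_of R1 R2) ss) end.

Fixpoint embed (u : tree) : term :=
  match u with Nd a us => App a (map embed us) end.

Lemma eval_embed v u : eval v (embed u) = u.
Proof.
elim/tree_Forall_ind: u => a us H /=; congr Nd; rewrite -map_comp.
by elim: H => //= u us' -> _ ->.
Qed.

Lemma item_of_covers R1 R2 s : covers
  (fun b t => covers (fun x u => x = embed u) b (run R2 t)) (item_of R1 R2 s) (run R1 s).
Proof.
elim/tree_Forall_ind: s => a ss H; apply: fire_covers.
  move=> n bs ts; apply: fire_covers => {}n xs us Hx /=; congr App.
  by elim: Hx => //= x u xs' us' -> _ ->.
by elim: H => *; constructor.
Qed.

Lemma item_of_realized R1 R2 s : realized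
  (fun b t => realized (fun x u => x = embed u) b (run R2 t)) (item_of R1 R2 s) (run R1 s).
Proof.
elim/tree_Forall_ind: s => a ss H; apply: fire_realized.
  move=> n bs ts; apply: fire_realized => {}n xs us Hx /=; congr App.
  by elim: Hx => //= x u xs' us' -> _ ->.
by elim: H => *; constructor.
Qed.

Lemma mem_levelS S R1 R2 n I : I \in level S R1 R2 n.+1 <->
  exists a Is, [/\ (a, size Is) \in S, {subset Is <= level S R1 R2 n} &
                   I = trans R1 R2 a Is].
Proof.
rewrite /level iterS; split.
  case/flattenP => ? /mapP[[a k] aS ->] /mapP[Is /prods_nseqP[sIs sub] ->].
  by exists a, Is; rewrite sIs.
move=> [a [Is [aS sub ->]]]; apply/flattenP.
eexists; first by apply/mapP; exists (a, size Is).
by apply: map_f; apply/prods_nseqP.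
Qed.

Lemma level_item_of S R1 R2 n I : I \in level S R1 R2 n ->
  exists2 s, in_T S s & I = item_of R1 R2 s.
Proof.
elim: n I => // n IH I /mem_levelS[a [Is [aS sub ->]]].
have [ss [Hss sz ->]] : exists ss,
    [/\ Forall (in_T S) ss, size Is = size ss & Is = map (item_of R1 R2) ss].
  elim: Is sub {aS} => [|J Is IHIs] sub; first by exists [::].
  have [s sS ->] := IH _ (sub _ (mem_head _ _)).
  have [|ss [Hss sz ->]] := IHIs.
    by move=> K KIs; apply: sub; rewrite inE KIs orbT.
  by exists (s :: ss); split; [constructor | rewrite /= size_map |].
by exists (Nd a ss) => //; apply/in_T_Nd; rewrite -sz.
Qed.

(** Stated for all later levels, so that the finitely many subtrees of a node share one. *)
Lemma item_of_level S R1 R2 s : in_T S s ->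
  exists n, forall m, n <= m -> item_of R1 R2 s \in level S R1 R2 m.
Proof.
elim/tree_Forall_ind: s => a ss IH /in_T_Nd[aS Hss].
have [n Hn] : exists n, forall m, n <= m ->
    {subset map (item_of R1 R2) ss <= level S R1 R2 m}.
  elim: Hss IH {aS} => [|s ss' sS _ IHss] IH; first by exists 0.
  inversion IH as [|? ? Hs Hss']; subst.
  have [n Hn] := IHss Hss'; have [k Hk] := Hs sS; exists (maxn n k) => m.
  rewrite geq_max => /andP[nm km] I /=; rewrite inE => /orP[/eqP->|]; first exact: Hk.
  exact: Hn.
exists n.+1 => -[|m] // nm; apply/mem_levelS; exists a, (map (item_of R1 R2) ss).
by rewrite size_map; split=> //; apply: Hn.
Qed.

Lemma conflictP S R1 R2 q0 p0 :
  (exists n, has (conflict q0 p0) (level S R1 R2 n)) <-> ~ unique_on S R1 R2 q0 p0.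
Proof.
split.
  case=> n /hasP[I /level_item_of[s sS ->] /hasP[x xI /hasP[y yI neq_xy]]] uq.
  have real z : z \in finals q0 p0 (item_of R1 R2 s) ->
      exists2 u, composed R1 R2 q0 p0 s u & z = embed u.
    case/mem_finals => b /item_of_realized[t Ht Hb] /Hb[u Hu ->].
    by exists u => //; exists t.
  have [u Hu xu] := real _ xI; have [u' Hu' yu'] := real _ yI.
  by move: neq_xy; rewrite xu yu' (uq s sS u u') ?eqxx.
move=> nuq; apply: contrapT => noconf; apply: nuq => s sS u u' [t Ht Hu] [t' Ht' Hu'].
have [n /(_ n (leqnn n)) In] := item_of_level R1 R2 sS.
have fin t1 u1 : run R1 s q0 t1 -> run R2 t1 p0 u1 ->
    embed u1 \in finals q0 p0 (item_of R1 R2 s).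
  move=> Ht1 Hu1; have [b bI Hb] := @item_of_covers R1 R2 s _ _ Ht1.
  by have [x xb <-] := Hb _ _ Hu1; apply/mem_finals; exists b.
apply: (can_inj (eval_embed (fun=> u))).
case: (eqVneq (embed u) (embed u')) => // neq; case: noconf; exists n.
apply/hasP; eexists; first exact: In.
by apply/hasP; exists (embed u); [exact: fin Ht Hu | apply/hasP; exists (embed u');
  [exact: fin Ht' Hu'|]].
Qed.

(** * Equations between terms *)

Fixpoint tree_size (t : tree) : nat :=
  match t with Nd a ts => (sumn (map tree_size ts)).+1 end.

Lemma tree_size_var w t x : x \in vars t -> tree_size (w x) <= tree_size (eval w t).
Proof.
elim/gtree_ind: t => [y|n ts IH]; first by rewrite mem_seq1 => /eqP->.
rewrite mem_vars_App => /hasP[t tts xt]; apply: leq_trans (IH t tts xt) _.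
rewrite /= -map_comp; apply: leqW; elim: ts tts {IH} => //= t' ts IH.
by rewrite inE => /orP[/eqP<-|/IH le]; [apply: leq_addr | apply: leq_trans le (leq_addl _ _)].
Qed.

Lemma vars_embed u : vars (embed u) = [::].
Proof.
elim/tree_Forall_ind: u => a us H; rewrite -[LHS]/(flatten (map vars (map embed us))).
by elim: H => //= u us' -> _ ->.
Qed.

Lemma eval_tsubst_id w s a : (forall x, eval w (s x) = w x) ->
  eval w (tsubst s a) = eval w a.
Proof.
by move=> ws; rewrite /eval gfold_tsubst; apply: eq_in_gfold => x _; apply: ws.
Qed.

Section Equations.
Variable V : (nat -> tree) -> Prop.

(** The system of equations is given by its set [V] of solutions and consists of everything that
    holds on [V]; no finite list of equations has to be extracted. *)
Definition valid (a b : term) : Prop := forall w, V w -> eval w a = eval w b.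

(** The occurs check: if [x] occurred below the root, its value would be smaller than itself. *)
Lemma valid_Var_App x n ts w : V w -> valid (Var x) (App n ts) -> x \notin vars (App n ts).
Proof.
move=> Vw /(_ w Vw) /= e; rewrite (mem_vars_App n).
apply/negP => /hasP[t tts xt].
have : tree_size (w x) <= sumn (map (tree_size \o eval w) ts).
  elim: ts tts {e} => //= t' ts IH; rewrite inE => /orP[/eqP<-|/IH le].
    by apply: leq_trans (tree_size_var w xt) (leq_addr _ _).
  exact: leq_trans le (leq_addl _ _).
by rewrite e /= -map_comp ltnn.
Qed.

(** Robinson's disagreement pair: descend while the root symbols agree. Two distinct symbols cannot
    face each other because the equation has a solution [w], so the descent ends at a variable, to
    which the occurs check applies. *)
Lemma valid_disagree a b w : V w -> valid a b -> a <> b ->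
  exists y t, [/\ y \in vars a ++ vars b, y \notin vars t,
                  {subset vars t <= vars a ++ vars b} & valid (Var y) t].
Proof.
move=> Vw; elim/gtree_ind: a b => [x|n ts IH] [y|m us] ab neq.
- exists x, (Var y); split=> //.
  + by rewrite mem_cat mem_seq1 eqxx.
  + by rewrite mem_seq1; apply/eqP => exy; apply: neq; rewrite exy.
  + by move=> z zy; rewrite mem_cat zy orbT.
- exists x, (App m us); split=> //.
  + by rewrite mem_cat mem_seq1 eqxx.
  + exact: valid_Var_App Vw ab.
  + by move=> z zy; rewrite mem_cat zy orbT.
- have ba : valid (Var y) (App n ts) by move=> v /ab.
  exists y, (App n ts); split=> //.
  + by rewrite mem_cat mem_seq1 eqxx orbT.
  + exact: valid_Var_App Vw ba.
  + by move=> z zy; rewrite mem_cat zy.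
- have enm : n = m by have := ab w Vw; case.
  have {}ab v : V v -> map (eval v) ts = map (eval v) us by move=> /ab[].
  have {neq} : ts <> us by move=> e; apply: neq; rewrite enm e.
  suff H : ts <> us -> exists y t, [/\ y \in flatten (map vars ts) ++ flatten (map vars us),
      y \notin vars t, {subset vars t <= flatten (map vars ts) ++ flatten (map vars us)}
      & valid (Var y) t] by [].
  elim: ts us IH ab {enm} => [|t ts IHts] [|u us] IH ab //.
  + by have := ab w Vw.
  + by have := ab w Vw.
  + move=> neq; have sub z : z \in vars t ++ vars u ->
        z \in flatten (map vars (t :: ts)) ++ flatten (map vars (u :: us)).
      by rewrite /= !mem_cat => /orP[] ->; rewrite ?orbT.
    have sub' z : z \in flatten (map vars ts) ++ flatten (map vars us) ->
        z \in flatten (map vars (t :: ts)) ++ flatten (map vars (u :: us)).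
      by rewrite /= !mem_cat => /orP[] ->; rewrite ?orbT.
    have [etu|/eqP ntu] := eqVneq t u.
      have [| | |y [t' [y1 y2 y3 y4]]] := IHts us.
      * by move=> t' t'ts; apply: IH; rewrite inE t'ts orbT.
      * by move=> v /ab[].
      * by move=> e; apply: neq; rewrite etu e.
      by exists y, t'; split=> // [|z /y3]; apply: sub'.
    have [|y [t' [y1 y2 y3 y4]]] := IH t (mem_head _ _) u _ ntu.
      by move=> v /ab[].
    by exists y, t'; split=> // [|z /y3]; apply: sub.
Qed.

(* A system of term equations has a most general solution in solved form:
   every valid equation that is not yet a syntactic identity eliminates one of
   the finitely many free variables. *)
Lemma principal_solution (X : seq nat) (d : tree) :
  (exists w, V w) -> (forall w x, V w -> x \notin X -> w x = d) ->
  exists s : nat -> term,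
    [/\ forall w x, V w -> eval w (s x) = w x,
        forall a b, valid a b -> tsubst s a = tsubst s b,
        forall x y, y \in vars (s x) -> s y = Var y &
        forall x y, y \in vars (s x) -> y \in X].
Proof.
move=> [w0 Vw0] Hd.
suff H n : forall (Y : seq nat) s, size Y <= n -> {subset Y <= X} ->
    (forall w x, V w -> eval w (s x) = w x) ->
    (forall x y, y \in vars (s x) -> y \in Y) -> (forall y, y \in Y -> s y = Var y) ->
    exists s : nat -> term,
    [/\ forall w x, V w -> eval w (s x) = w x,
        forall a b, valid a b -> tsubst s a = tsubst s b,
        forall x y, y \in vars (s x) -> s y = Var y &
        forall x y, y \in vars (s x) -> y \in X].
  (* Variables outside [X] have the constant value [d], so the initial substitution may make them
     ground; only those of [X] are free. *)
  apply: (H (size X) X (fun x => if x \in X then Var x else embed d)) => //.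
  - move=> w x Vw; case: ifP => // xX; rewrite eval_embed Hd ?xX //.
  - move=> x y; case: ifP => xX; first by rewrite mem_seq1 => /eqP->.
    by rewrite vars_embed.
  - by move=> y ->.
elim: n => [|n IH] Y s sY YX s1 s2 s3; (case: (pselect (exists a b,
  valid a b /\ tsubst s a <> tsubst s b)) => [[a [b [ab neq]]]|no]; last first;
  [exists s; split=> // [a b ab|x y /s2/s3|x y /s2/YX] //;
   by apply: contrapT => neq; apply: no; exists a, b|]).
all: have {}ab : valid (tsubst s a) (tsubst s b)
  by move=> w Vw; rewrite !eval_tsubst_id ?(ab w Vw) // => x; apply: s1.
all: have [y [t [yab yt tab ytV]]] := valid_disagree Vw0 ab neq.
all: have subY z : z \in vars (tsubst s a) ++ vars (tsubst s b) -> z \in Y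
  by rewrite mem_cat => /orP[] /vars_tsubst[x _ /s2].
(* With no free variable left there is no variable at which the two sides could disagree. *)
- by have := subY _ yab; case: Y sY {YX s2 s3 subY}.
pose e z := if z == y then t else Var z.
apply: (IH (filter (predC1 y) Y) (fun x => tsubst e (s x))).
- rewrite -ltnS; apply: leq_trans sY; rewrite size_filter.
  rewrite -(count_predC (pred1 y) Y) -addn1 addnC leq_add2r -has_count.
  by apply/hasP; exists y; rewrite /= ?eqxx //; apply: subY.
- by move=> z; rewrite mem_filter => /andP[_ /YX].
- move=> w x Vw; rewrite -[RHS](s1 w x Vw) /eval gfold_tsubst.
  by apply: eq_in_gfold => z _; rewrite /e; case: eqP => // ->; rewrite -[LHS](ytV w).
- move=> x z /vars_tsubst[z' z'x]; rewrite /e mem_filter /=; case: eqP => [_ zt|nz].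
    by rewrite (subY _ (tab _ zt)) andbT; apply: contraNneq yt => <-.
  by rewrite mem_seq1 => /eqP ->; rewrite (s2 _ _ z'x) andbT; apply/eqP.
- move=> z; rewrite mem_filter => /andP[/= ny /s3->].
  by rewrite /= /e (negbTE ny).
Qed.

End Equations.

(** * Existence of certificates *)

Lemma fun_choice (X Y : Type) (P : X -> Y -> Prop) :
  (forall x, exists y, P x y) -> exists f, forall x, P x (f x).
Proof. by case/boolp.choice => f; exists f. Qed.

Fixpoint sublists (T : Type) (s : seq T) : seq (seq T) :=
  if s is x :: s' then map (cons x) (sublists s') ++ sublists s' else [:: [::]].

Lemma mem_sublists (T : eqType) (p : pred T) s : filter p s \in sublists s.
Proof.
elim: s => //= x s IH; rewrite mem_cat; case: ifP => _; rewrite ?IH ?orbT //.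
by rewrite map_f.
Qed.

Lemma run_state R t p u : run R t p u -> p \in map (fun rl => rl.1.1) R.
Proof. by case: t => a ts [r rR _]; apply/mapP; exists (p, a, r). Qed.

Section Completeness.
Variables (S : ralph) (R1 R2 : rules) (q0 p0 : nat).

Definition states2 := map (fun rl : nat * nat * rhs => rl.1.1) R2.

(* Filtering a fixed list makes [ty] and [cl] canonical, hence finite in number. *)
Definition ty (t : tree) : seq nat := [seq p <- states2 | `[< exists u, run R2 t p u >]].

Lemma mem_ty t p : p \in ty t <-> exists u, run R2 t p u.
Proof.
rewrite mem_filter; split=> [/andP[/asboolP]//|H].
by rewrite (introT (asboolP _) H) /=; case: H => u /run_state.
Qed.

Notation class := (seq (nat * seq nat)).

Definition keys : class :=
  [seq (q, P) | q <- map (fun rl => rl.1.1) R1, P <- sublists states2].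

Definition cl (s : tree) : class :=
  [seq k <- keys | `[< exists2 t, run R1 s k.1 t & ty t = k.2 >]].

Lemma mem_cl s k : k \in cl s <-> exists2 t, run R1 s k.1 t & ty t = k.2.
Proof.
rewrite mem_filter; split=> [/andP[/asboolP]//|H].
rewrite (introT (asboolP _) H) /=; case: k H => q P [t /= Ht <-].
by apply/allpairsP; exists (q, ty t); rewrite mem_sublists (run_state Ht).
Qed.

(** Both results are taken on the same input [s]; between inputs of the class the value may vary. *)
Definition uniq_out (c : class) (k : nat * seq nat) (p : nat) : Prop :=
  forall s t t' u u', in_T S s -> cl s = c -> run R1 s k.1 t -> ty t = k.2 ->
    run R1 s k.1 t' -> ty t' = k.2 -> run R2 t p u -> run R2 t' p u' -> u = u'.

(** The successor keeps the variable 0 free for unknown results. *)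
Definition vr (k : nat * seq nat) (p : nat) : nat := (pickle (k, p)).+1.

Lemma vr_inj k p k' p' : vr k p = vr k' p' -> k = k' /\ p = p'.
Proof. by case=> /(pcan_inj pickleK)[]. Qed.

(** [f] chooses the term standing for each triple: [Var] gives the most general item of a class,
    [solved c] the item put into the certificate. *)
Definition generic (f : nat -> term) (c : class) : item :=
  [seq (k.1, [seq (p, f (vr k p)) | p <- k.2]) | k <- c].

Lemma mem_generic f c q b : (q, b) \in generic f c <->
  exists2 P, (q, P) \in c & b = [seq (p, f (vr (q, P) p)) | p <- P].
Proof.
split; first by case/mapP => -[q' P] kc [-> ->]; exists P.
by case=> P kc ->; apply/mapP; exists (q, P).
Qed.

(** A sample of the variables of a class on the input [s]. All results at one key come from a single
    output [t], in accordance with the copying of [T2]. *)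
Definition selects (s : tree) (v : nat -> tree) : Prop := forall k, k \in cl s ->
  exists t, [/\ run R1 s k.1 t, ty t = k.2 & forall p, p \in k.2 -> run R2 t p (v (vr k p))].

(** Keys are treated independently, so any one result can be prescribed and completed. Two different
    results of a triple thus give two selections that differ at its variable. *)
Lemma selects_ex s k t p u : run R1 s k.1 t -> ty t = k.2 -> run R2 t p u ->
  exists2 v, selects s v & v (vr k p) = u.
Proof.
move=> Ht tyt Hu.
have F k' : exists g : nat -> tree,
    (k' \in cl s -> exists t, [/\ run R1 s k'.1 t, ty t = k'.2 &
       forall p, p \in k'.2 -> run R2 t p (g p)]) /\ (k' = k -> g p = u).
  have real t' : exists g : nat -> tree, (forall p, p \in ty t' -> run R2 t' p (g p)) /\
      (run R2 t' p u -> g p = u).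
    pose P p' w := (p' \in ty t' -> run R2 t' p' w) /\ (p' = p -> run R2 t' p u -> w = u).
    have [|g Hg] := @fun_choice _ _ P.
      move=> p'; have [[-> Hu']|no] := pselect (p' = p /\ run R2 t' p u).
        by exists u.
      have [/mem_ty[w Hw]|no'] := pselect (p' \in ty t'); last by exists u.
      by exists w; split=> // ep Hu'; case: no.
    by exists g; split=> [p' /(proj1 (Hg p'))//|]; apply: (proj2 (Hg p)).
  have [->|nk] := pselect (k' = k).
    have [g [Hg gp]] := real t; exists g; split=> [_|_]; last exact: gp.
    by exists t; rewrite -tyt.
  have [/mem_cl[t' Ht' ty']|no] := pselect (k' \in cl s); last by exists (fun=> u).
  have [g [Hg _]] := real t'; exists g; split=> // _.
  by exists t'; rewrite -ty'.
have [g Hg] := fun_choice F.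
exists (fun y => if y is z.+1 then
    if unpickle z is Some kp then g kp.1 kp.2 else u else u).
  move=> k' k'c; have [t' [H1 H2 H3]] := (proj1 (Hg k')) k'c; exists t'; split=> // p' p'k.
  by rewrite /vr pickleK; apply: H3.
by rewrite /vr pickleK; apply: (proj2 (Hg k)).
Qed.

Lemma selects_inh s : exists v, selects s v.
Proof.
have [[[q P] [p [t [Ht tyt [u Hu]]]]]|no] := pselect (exists k p t,
  [/\ run R1 s k.1 t, ty t = k.2 & exists u, run R2 t p u]).
  by have [v Hv _] := @selects_ex s (q, P) t p u Ht tyt Hu; exists v.
exists (fun=> Nd 0 [::]) => k /mem_cl[t Ht tyt]; exists t; split=> // p.
by rewrite -tyt => /mem_ty Hu; case: no; exists k, p, t.
Qed.

Definition dom_rel (b : beh) (t : tree) : Prop :=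
  covers (fun _ _ => True) b (run R2 t) /\ realized (fun _ _ => True) b (run R2 t).

(** Domains agree in both directions, but values only need to be results: a selection fixes one of
    possibly many. *)
Definition val_rel v (b : beh) (t : tree) : Prop :=
  covers (fun _ _ => True) b (run R2 t) /\ beh_realized R2 v b t.

Lemma val_dom_rel v b t : val_rel v b t -> dom_rel b t.
Proof. by case=> H1 H2; split=> // p x /H2[u]; exists u. Qed.

Lemma Forall2_and (X Y : Type) (P Q : X -> Y -> Prop) xs ys :
  Forall2 (fun x y => P x y /\ Q x y) xs ys -> Forall2 P xs ys /\ Forall2 Q xs ys.
Proof. by elim=> [|x y ? ? [Px Qx] _ [? ?]]; split; constructor. Qed.

Lemma fire_dom_rel n bs ts : Forall2 dom_rel bs ts -> dom_rel (fire App R2 n bs) (Nd n ts).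
Proof. by move=> /Forall2_and[? ?]; split; [apply: fire_covers | apply: fire_realized]. Qed.

Lemma fire_val_rel v n bs ts :
  Forall2 (val_rel v) bs ts -> val_rel v (fire App R2 n bs) (Nd n ts).
Proof.
by move=> /Forall2_and[? ?]; split; [apply: fire_covers | apply: fire_beh_realized].
Qed.

Definition dom (b : beh) : seq nat := [seq p <- states2 | p \in map fst b].

Lemma mem_fst (b : beh) p : p \in map fst b <-> exists x, (p, x) \in b.
Proof.
split; first by case/mapP => -[p' x] xb ->; exists x.
by case=> x xb; apply/mapP; exists (p, x).
Qed.

Lemma dom_ty b t : dom_rel b t -> dom b = ty t.
Proof.
case=> H1 H2; apply: eq_filter => p; apply/idP/asboolP.
  by move=> /mem_fst[x /H2[u Hu _]]; exists u.
by case=> u /H1[x xb _]; apply/mem_fst; exists x.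
Qed.

Definition ren_generic i (c : class) : item :=
  item_map (fun x => Var (mark i x)) (generic Var c).

Lemma mem_ren_generic i c q b : (q, b) \in ren_generic i c <->
  exists2 P, (q, P) \in c & b = [seq (p, Var (mark i (vr (q, P) p))) | p <- P].
Proof.
rewrite mem_lmap; split.
  by case=> b' /mem_generic[P kc ->] ->; exists P => //; rewrite /beh_map /lmap -map_comp.
case=> P kc ->; exists [seq (p, Var (vr (q, P) p)) | p <- P].
  by apply/mem_generic; exists P.
by rewrite /beh_map /lmap -map_comp.
Qed.

Lemma ren_generic_covers i s : covers dom_rel (ren_generic i (cl s)) (run R1 s).
Proof.
move=> q t Ht; exists [seq (p, Var (mark i (vr (q, ty t) p))) | p <- ty t].
  by apply/mem_ren_generic; exists (ty t) => //; apply/mem_cl; exists t.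
split=> [p u Hu|p x /mapP[p' /mem_ty[u Hu] [-> _]]]; last by exists u.
exists (Var (mark i (vr (q, ty t) p))) => //; apply/mapP; exists p => //.
by apply/mem_ty; exists u.
Qed.

Lemma ren_generic_realized vs i s : selects s (vs i) ->
  realized (val_rel (merge_val vs)) (ren_generic i (cl s)) (run R1 s).
Proof.
move=> sel q b /mem_ren_generic[P kc ->]; have [t [Ht tyt Hp]] := sel _ kc.
exists t => //; split.
  move=> p u Hu; exists (Var (mark i (vr (q, P) p))) => //; apply/mapP; exists p => //.
  by rewrite -[P]tyt; apply/mem_ty; exists u.
move=> p x /mapP[p' p'P [-> ->]]; exists (vs i (vr (q, P) p')); first exact: Hp.
by rewrite -[LHS]/(merge_val vs (mark i (vr (q, P) p'))) /merge_val markK.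
Qed.

(** * The symbolic step on generic items *)

Definition generic_trans a (cs : seq class) : item :=
  trans R1 R2 a (rename (map (generic Var) cs)).

Lemma rename_generic cs : rename (map (generic Var) cs) =
  mkseq (fun i => ren_generic i (nth [::] cs i)) (size cs).
Proof.
rewrite /rename size_map; apply: eq_mkseq => i; rewrite /ren_generic.
by congr item_map; elim: cs i => [|c cs IH] [|i] /=.
Qed.

Section Step.
Variables (a : nat) (cs : seq class).

Definition of_classes (ss : seq tree) := map cl ss = cs.

Lemma step_covers ss : of_classes ss ->
  covers dom_rel (generic_trans a cs) (run R1 (Nd a ss)).
Proof.
move=> <-; apply: fire_covers; first exact: fire_dom_rel.
rewrite rename_generic size_map.
apply: (Forall2_of_nth (x0 := [::]) (y0 := Nd 0 [::])); first by rewrite size_mkseq.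
move=> i iss; rewrite nth_mkseq // (nth_map (Nd 0 [::])) //.
exact: ren_generic_covers.
Qed.

Lemma step_realized ss vs : of_classes ss ->
  (forall i, i < size ss -> selects (nth (Nd 0 [::]) ss i) (vs i)) ->
  realized (val_rel (merge_val vs)) (generic_trans a cs) (run R1 (Nd a ss)).
Proof.
move=> <- sel; apply: fire_realized; first exact: fire_val_rel.
rewrite rename_generic size_map.
apply: (Forall2_of_nth (x0 := [::]) (y0 := Nd 0 [::])); first by rewrite size_mkseq.
move=> i iss; rewrite nth_mkseq // (nth_map (Nd 0 [::])) //.
exact/ren_generic_realized/sel.
Qed.

Lemma step_selects ss : exists vs, forall i, i < size ss ->
  selects (nth (Nd 0 [::]) ss i) (vs i).
Proof.
have [i|vs Hvs] := @fun_choice _ _ (fun i => selects (nth (Nd 0 [::]) ss i)).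
  exact: selects_inh.
by exists vs.
Qed.

(** [step_covers] and [step_realized] give the two inclusions. The right-hand side depends on [a]
    and [cs] only, so having the same class is a congruence, and subtrees of equal class may be
    exchanged. *)
Lemma step_cl ss : of_classes ss -> cl (Nd a ss) =
  [seq k <- keys | `[< exists2 b, (k.1, b) \in generic_trans a cs & dom b = k.2 >]].
Proof.
move=> Hss; apply: eq_filter => -[q P] /=; apply/asboolP/asboolP.
  by case=> t /(step_covers Hss)[b bH /dom_ty <-] ty_t; exists b.
have [vs Hvs] := step_selects ss.
case=> b /(step_realized Hss Hvs)[t Ht /val_dom_rel/dom_ty ->] ty_t.
by exists t.
Qed.

Definition entry (k : nat * seq nat) p x : Prop :=
  exists b, [/\ (k.1, b) \in generic_trans a cs, dom b = k.2 & (p, x) \in b].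

Lemma entry_realized ss vs k p x : of_classes ss ->
  (forall i, i < size ss -> selects (nth (Nd 0 [::]) ss i) (vs i)) -> entry k p x ->
  exists t, [/\ run R1 (Nd a ss) k.1 t, ty t = k.2 & run R2 t p (eval (merge_val vs) x)].
Proof.
move=> Hss Hvs [b [bH db xb]]; have [t Ht Hb] := step_realized Hss Hvs bH.
exists t; split=> //; first by rewrite -db (dom_ty (val_dom_rel Hb)).
by case: Hb => _ /(_ _ _ xb)[u Hu ->].
Qed.

Definition all_vars : seq nat :=
  flatten [seq flatten [seq [seq mark i (vr k p) | p <- k.2] | k <- nth [::] cs i]
          | i <- iota 0 (size cs)].

Lemma all_varsP y : y \in all_vars -> exists i k p,
  [/\ y = mark i (vr k p), i < size cs, k \in nth [::] cs i & p \in k.2].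
Proof.
case/flattenP => ? /mapP[i]; rewrite mem_iota => /= ics -> /flattenP[? /mapP[k kc ->]].
by case/mapP => p pk ->; exists i, k, p.
Qed.

Lemma mem_all_vars i k p : i < size cs -> k \in nth [::] cs i -> p \in k.2 ->
  mark i (vr k p) \in all_vars.
Proof.
move=> ics kc pk; apply/flattenP; eexists.
  by apply/mapP; exists i; rewrite ?mem_iota.
apply/flattenP; eexists; first by apply/mapP; exists k.
exact: map_f.
Qed.

(* By naturality: a substitution that fixes the variables of the arguments of
   [trans] fixes its result. *)
Lemma entry_vars k p x y : entry k p x -> y \in vars x -> y \in all_vars.
Proof.
case=> b [bH _ xb] yx.
pose s z := if z \in all_vars then Var z else App 0 [::].
have sI : map (item_map s) (rename (map (generic Var) cs)) = rename (map (generic Var) cs).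
  rewrite rename_generic /mkseq -map_comp; apply/eq_in_map => i.
  rewrite mem_iota => /= ics; rewrite /item_map /lmap -[RHS]map_id.
  apply/eq_in_map => -[q b'] /mem_ren_generic[P kc ->] /=; congr pair.
  rewrite /beh_map /lmap -map_comp; apply/eq_in_map => p' p'P /=.
  by rewrite /s mem_all_vars.
have := trans_item_map R1 R2 a s (rename (map (generic Var) cs)).
rewrite sI -/(generic_trans a cs) => e.
have /eq_in_map/(_ _ bH)[eb] : item_map s (generic_trans a cs) = map id (generic_trans a cs).
  by rewrite map_id.
have /eq_in_map/(_ _ xb)[ex] : beh_map s b = map id b by rewrite map_id.
apply: contraT => ny; have : y \in vars (tsubst s x) by rewrite ex.
case/vars_tsubst => z _; rewrite /s; case: ifP => // zv.
by rewrite mem_seq1 => /eqP eyz; rewrite eyz zv in ny.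
Qed.

End Step.

Hypothesis functional : unique_on S R1 R2 q0 p0.

Definition realizable (c : class) : Prop := exists2 s, in_T S s & cl s = c.

Definition known (c : class) : seq nat :=
  flatten [seq [seq vr k p | p <- k.2 & `[< uniq_out c k p >]] | k <- c].

Lemma knownP c z : z \in known c -> exists k p,
  [/\ z = vr k p, k \in c, p \in k.2 & uniq_out c k p].
Proof.
case/flattenP => ? /mapP[k kc ->] /mapP[p]; rewrite mem_filter => /andP[/asboolP ukp pk] ->.
by exists k, p.
Qed.

Lemma mem_known (c : class) k p : k \in c -> p \in k.2 -> uniq_out c k p -> vr k p \in known c.
Proof.
move=> kc pk /asboolP ukp; apply/flattenP; eexists; first by apply/mapP; exists k.
by apply: map_f; rewrite mem_filter ukp.
Qed.

Lemma known_gt0 c z : z \in known c -> 0 < z.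
Proof. by case/knownP => k [p [-> _ _ _]]. Qed.

(** The valuations that occur on actual inputs of the class, cut down to known triples. The constant
    value elsewhere leaves [principal_solution] with finitely many free variables. *)
Definition vals (c : class) (w : nat -> tree) : Prop := exists s v,
  [/\ in_T S s, cl s = c, selects s v &
      forall x, w x = if x \in known c then v x else Nd 0 [::]].

Lemma selects_vals s v : in_T S s -> selects s v ->
  vals (cl s) (fun x => if x \in known (cl s) then v x else Nd 0 [::]).
Proof. by move=> sS Hv; exists s, v. Qed.

Lemma vals_inh c : realizable c -> exists w, vals c w.
Proof.
by case=> s sS <-; have [v Hv] := selects_inh s; eexists; apply: selects_vals Hv.
Qed.

Definition solution (c : class) (th : nat -> term) : Prop :=
  [/\ forall w x, vals c w -> eval w (th x) = w x,
      forall a b, valid (vals c) a b -> tsubst (th) a = tsubst (th) b,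
      forall x y, y \in vars (th x) -> th y = Var y &
      forall x y, y \in vars (th x) -> y \in known c].

Lemma exists_solution : exists theta : class -> nat -> term,
  forall c, realizable c -> solution c (theta c).
Proof.
apply: (@fun_choice _ _ (fun c th => realizable c -> solution c th)).
move=> c; have [rc|nrc] := pselect (realizable c); last by exists Var.
have [||th Hth] := @principal_solution (vals c) (known c) (Nd 0 [::]).
- exact: vals_inh.
- by move=> w x [s [v [_ _ _ ->]]] /negbTE->.
by exists th.
Qed.

Section Solved.
Variable theta : class -> nat -> term.
Hypothesis thetaP : forall c, realizable c -> solution c (theta c).

Definition solved (c : class) (x : nat) : term :=
  if x \in known c then theta c x else Var 0.

Lemma unk_theta c x : realizable c -> unk (theta c x) = false.
Proof.
move=> /thetaP[_ _ _ th]; apply/negbTE; rewrite unkE; apply/negP => /th.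
by move/known_gt0.
Qed.

Lemma item_map_generic s f c :
  item_map s (generic f c) = generic (fun x => tsubst s (f x)) c.
Proof.
rewrite /item_map /lmap -map_comp; apply: eq_map => k /=; congr pair.
by rewrite /beh_map /lmap -map_comp.
Qed.

Lemma eq_generic f g c : (forall k p, f (vr k p) = g (vr k p)) -> generic f c = generic g c.
Proof.
by move=> e; apply: eq_map => k; congr pair; apply: eq_map => p; rewrite e.
Qed.

(** The solutions of the argument classes, acting together on the disjoint copies of their
    variables. *)
Definition joint (cs : seq class) (y : nat) : term :=
  tsubst (fun x => Var (mark (unmark y).1 x))
    (solved (nth [::] cs (unmark y).1) (unmark y).2).

(** Solved arguments are instances of generic ones, so by naturality their step is an instance of
    [generic_trans]. *)
Lemma rename_solved cs : rename (map (fun c => generic (solved c) c) cs) =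
  map (item_map (joint cs)) (rename (map (generic Var) cs)).
Proof.
rewrite rename_generic /rename size_map /mkseq -map_comp; apply/eq_in_map => i.
rewrite mem_iota => /= ics; rewrite (nth_map [::]) // /ren_generic !item_map_generic.
by apply: eq_generic => k p; rewrite -[RHS]/(joint cs (mark i (vr k p))) /joint markK.
Qed.

Definition known_in (cs : seq class) (y : nat) : Prop := exists i z,
  [/\ y = mark i z, i < size cs & z \in known (nth [::] cs i)].

Lemma joint_known cs i z : z \in known (nth [::] cs i) ->
  joint cs (mark i z) = tsubst (fun x => Var (mark i x)) (theta (nth [::] cs i) z).
Proof. by move=> zk; rewrite /joint markK ?(known_gt0 zk) //= /solved zk. Qed.

Lemma tsubst_embed s u : tsubst s (embed u) = embed u.
Proof.
rewrite -[RHS]tsubst_id /tsubst; apply: eq_in_gfold => x.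
by rewrite vars_embed.
Qed.

(* Equations valid for independent choices of the arguments follow from the
   equations of each argument separately: otherwise fix all but one of them. *)
Lemma joint_valid cs a b :
  (forall i, i < size cs -> realizable (nth [::] cs i)) ->
  (forall y, y \in vars a ++ vars b -> known_in cs y) ->
  (forall ws, (forall i, i < size cs -> vals (nth [::] cs i) (ws i)) ->
     eval (merge_val ws) a = eval (merge_val ws) b) ->
  tsubst (joint cs) a = tsubst (joint cs) b.
Proof.
move=> rcs kab ab; apply: contrapT => neq.
have ev ws t : (forall i, i < size cs -> vals (nth [::] cs i) (ws i)) ->
    {subset vars t <= vars a ++ vars b} ->
    eval (merge_val ws) (tsubst (joint cs) t) = eval (merge_val ws) t.
  move=> Hws sub; rewrite /eval gfold_tsubst; apply: eq_in_gfold => y /sub/kab.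
  case=> i [z [-> ics zk]]; rewrite joint_known // -/(eval _ _) eval_ren.
    have [th _ _ _] := thetaP (rcs _ ics).
    rewrite th; last exact: Hws.
    by rewrite /merge_val markK ?(known_gt0 zk).
  by rewrite (unk_theta _ (rcs _ ics)).
have [ws0 Hws0] : exists ws, forall i, i < size cs -> vals (nth [::] cs i) (ws i).
  apply: (@fun_choice _ _ (fun i w => i < size cs -> vals (nth [::] cs i) w)) => i.
  have [/rcs/vals_inh[w Hw]|//] := boolP (i < size cs); first by exists w.
  by exists (fun=> Nd 0 [::]).
pose V w := exists2 ws, forall i, i < size cs -> vals (nth [::] cs i) (ws i) & w = merge_val ws.
have V0 : V (merge_val ws0) by exists ws0.
have Vab : valid V (tsubst (joint cs) a) (tsubst (joint cs) b).
  move=> _ [ws Hws ->]; rewrite !ev ?ab // => y yv; by rewrite mem_cat yv ?orbT.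
have [y [t [yab yt tab Vyt]]] := valid_disagree V0 Vab neq.
have inab y' : y' \in vars (tsubst (joint cs) a) ++ vars (tsubst (joint cs) b) ->
    exists i z, [/\ y' = mark i z, i < size cs, 0 < z & theta (nth [::] cs i) z = Var z].
  suff H t' : {subset vars t' <= vars a ++ vars b} -> y' \in vars (tsubst (joint cs) t') ->
    exists i z, [/\ y' = mark i z, i < size cs, 0 < z & theta (nth [::] cs i) z = Var z].
    by rewrite mem_cat => /orP[]; apply: H => x xv; rewrite mem_cat xv ?orbT.
  move=> sub /vars_tsubst[x /sub/kab[i [z [-> ics zk]]]]; rewrite joint_known //.
  have [_ _ th3 th4] := thetaP (rcs _ ics).
  case/vars_tsubst => z' z'th; rewrite mem_seq1 => /eqP->; exists i, z'.
  by rewrite (th3 _ _ z'th) (known_gt0 (th4 _ _ z'th)).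
have [i [z [ey ics z0 thz]]] := inab _ yab.
(* Keeps the variables of the i-th argument and fixes all others at their values under [ws0]. *)
pose e y' := if (unmark y').1 == i then Var (unmark y').2 else embed (merge_val ws0 y').
have vzt : valid (vals (nth [::] cs i)) (Var z) (tsubst e t).
  move=> w Hw; pose ws j := if j == i then w else ws0 j.
  have Vws : V (merge_val ws).
    by exists ws => // j jcs; rewrite /ws; case: eqP => [->|_]; last exact: Hws0.
  have := Vyt _ Vws; rewrite -[LHS]/(merge_val ws y) ey /merge_val markK // /ws eqxx /=.
  move=> ->; rewrite /eval gfold_tsubst; apply: eq_in_gfold => x _; rewrite /e.
  by case: eqP => //= _; rewrite -/(eval _ _) eval_embed.
have [_ th2 _ _] := thetaP (rcs _ ics).
(* Both sides of the equation in the i-th argument are already fixed by its solution, so they are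
   equal as terms; then [y] occurs in [t], a contradiction. *)
have := th2 _ _ vzt; rewrite [LHS]/= thz => ezt.
have {}ezt : Var z = tsubst e t.
  rewrite ezt /tsubst gfold_tsubst; apply: eq_in_gfold => x xt; rewrite /e.
  have [j [x' [-> jcs x'0 thx]]] := inab _ (tab _ xt); rewrite markK //=.
  by case: eqP => [eji|_]; [rewrite /= -eji thx | rewrite -/(tsubst _ _) tsubst_embed].
have : z \in vars (tsubst e t) by rewrite -ezt mem_seq1.
case/vars_tsubst => x xt; rewrite /e; case: eqP => [|_]; last by rewrite vars_embed.
have [j [x' [exx jcs x'0 _]]] := inab _ (tab _ xt).
rewrite exx markK //= mem_seq1 => eji /eqP ezx.
by move: yt; rewrite ey ezx -eji -exx xt.
Qed.

Section Covered.
Variables (a : nat) (cs : seq class) (ss : seq tree).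
Hypotheses (ss_cs : map cl ss = cs) (ssS : forall s, List.In s ss -> in_T S s)
  (aS : (a, size ss) \in S).

Let c := cl (Nd a ss).

Lemma in_T_step ss' :
  size ss' = size ss -> (forall i, i < size ss -> in_T S (nth (Nd 0 [::]) ss' i)) ->
  in_T S (Nd a ss').
Proof.
move=> sz H; apply/in_T_Nd; rewrite sz; split=> //; rewrite -sz in H.
elim: ss' H {sz} => [|s ss' IH] H; constructor; first exact: (H 0).
by apply: IH => i; apply: (H i.+1).
Qed.

Lemma in_T_nth i : i < size ss -> in_T S (nth (Nd 0 [::]) ss i).
Proof.
suff H l : (forall s, List.In s l -> in_T S s) ->
    forall i, i < size l -> in_T S (nth (Nd 0 [::]) l i) by apply: H.
elim: l => //= s l IH H [_|j]; first by apply: H; left.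
by apply: IH => s' Hs'; apply: H; right.
Qed.

Lemma cs_realizable i : i < size cs -> realizable (nth [::] cs i).
Proof.
rewrite -ss_cs size_map => iss; exists (nth (Nd 0 [::]) ss i); first exact: in_T_nth.
by rewrite (nth_map (Nd 0 [::])).
Qed.

Lemma c_in_T : in_T S (Nd a ss).
Proof. by apply: in_T_step => // i; apply: in_T_nth. Qed.

Lemma entry_key k p x : entry a cs k p x -> k \in c /\ p \in k.2.
Proof.
move=> kpx; have [vs Hvs] := step_selects ss.
have [t [Ht tyt Hx]] := entry_realized ss_cs Hvs kpx.
by split; [apply/mem_cl; exists t | rewrite -tyt; apply/mem_ty; eexists; exact: Hx].
Qed.

Lemma key_entry k p : k \in c -> p \in k.2 -> exists x, entry a cs k p x.
Proof.
case/mem_cl => t Ht tyt pk; have [b bH bt] := step_covers ss_cs Ht.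
have db : dom b = k.2 by rewrite -tyt; apply: dom_ty.
move: (pk); rewrite -db mem_filter => /andP[/mem_fst[x xb] _].
by exists x, b.
Qed.

(* Two values for an unknown triple below would give two values for [x]. *)
Lemma entry_known k p x y : uniq_out c k p -> entry a cs k p x -> y \in vars x ->
  known_in cs y.
Proof.
move=> ukp kpx yx; have [i [k' [p' [ey ics kc' pk']]]] := all_varsP (entry_vars kpx yx).
exists i, (vr k' p'); split=> //; apply: mem_known => //.
move=> s' t t' u u' s'S cs' Ht tyt Ht' tyt' Hu Hu'.
(* The two values live on [s'], not on the original subtree; having the same class, [s'] may take
   its place without changing the class [c]. *)
pose ss' := mkseq (fun j => if j == i then s' else nth (Nd 0 [::]) ss j) (size ss).
have szss' : size ss' = size ss by rewrite size_mkseq.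
have szcs : size cs = size ss by rewrite -ss_cs size_map.
have nth_ss' j : j < size ss ->
    nth (Nd 0 [::]) ss' j = if j == i then s' else nth (Nd 0 [::]) ss j.
  by move=> jss; rewrite nth_mkseq.
have ss'_cs : map cl ss' = cs.
  apply: (@eq_from_nth _ [::]); first by rewrite size_map szss' szcs.
  move=> j; rewrite size_map szss' => jss; rewrite (nth_map (Nd 0 [::])) ?szss' // nth_ss' //.
  by case: eqP => [->//|_]; rewrite -ss_cs (nth_map (Nd 0 [::])).
have [vs0 Hvs0] := step_selects ss'.
have ev v : selects s' v -> exists2 t1, run R1 (Nd a ss') k.1 t1 /\ ty t1 = k.2 &
    run R2 t1 p (eval (merge_val (fun j => if j == i then v else vs0 j)) x).
  move=> Hv; have [|t1 [H1 H2 H3]] := @entry_realized a cs ss' (fun j => if j == i then v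
      else vs0 j) k p x ss'_cs _ kpx.
    move=> j jss; case: eqP => [eji|_]; last exact: Hvs0.
    by rewrite nth_ss' -?szss' // eji eqxx.
  by exists t1.
have [v Hv vu] := selects_ex Ht tyt Hu; have [v' Hv' vu'] := selects_ex Ht' tyt' Hu'.
have [t1 [r1 ty1] o1] := ev _ Hv; have [t2 [r2 ty2] o2] := ev _ Hv'.
have clc : cl (Nd a ss') = c by rewrite /c (step_cl a ss'_cs) (step_cl a ss_cs).
have S' : in_T S (Nd a ss').
  apply: in_T_step => // j jss; rewrite nth_ss' //.
  by case: eqP => _ //; apply: in_T_nth.
(* The results at the root coincide, and a term with equal values has equal values at each of its
   variables. *)
have /eval_inj/(_ y yx) := ukp _ _ _ _ _ S' clc r1 ty1 r2 ty2 o1 o2.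
by rewrite /merge_val ey markK //= eqxx vu vu'.
Qed.

(** The substitution sends each known variable of [c] to the solved form of one entry [ch z] chosen
    for its triple. Any other entry of a known triple becomes equal to the corresponding instance of
    [theta c], because both sides have the same value on all inputs. *)
Lemma step_covered : exists s : seq term,
  covered (trans R1 R2 a (rename (map (fun c => generic (solved c) c) cs)))
    (generic (solved c) c) (nth (Var 0) s).
Proof.
have [ch Hch] : exists ch : nat -> term, forall z, z \in known c ->
    exists k p, [/\ z = vr k p, uniq_out c k p & entry a cs k p (ch z)].
  apply: (@fun_choice _ _ (fun z x => z \in known c ->
    exists k p, [/\ z = vr k p, uniq_out c k p & entry a cs k p x])) => z.
  have [/knownP[k [p [-> kc pk ukp]]]|] := boolP (z \in known c); last by exists (Var 0).
  by have [x kpx] := key_entry kc pk; exists x => _; exists k, p.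
pose tau z := tsubst (joint cs) (ch z).
(* Substitutions of a certificate are finite lists. This one reaches the largest known variable, and
   [theta c] uses only known variables. *)
exists (mkseq tau (\max_(y <- known c) y).+1).
have rc : realizable c by exists (Nd a ss) => //; apply: c_in_T.
have [th1 _ _ th4] := thetaP rc.
rewrite rename_solved -trans_item_map -/(generic_trans a cs).
apply/allP => -[q b'] /mem_lmap[b bH ->] /=.
have [vs Hvs] := step_selects ss; have [t Ht bt] := step_realized ss_cs Hvs bH.
have tyt := dom_ty (val_dom_rel bt).
have kc : (q, dom b) \in c by apply/mem_cl; exists t.
apply/hasP; exists (q, [seq (p, solved c (vr (q, dom b) p)) | p <- dom b]).
  by apply/mem_generic; exists (dom b).
rewrite /= eqxx; apply/allP => -[p x'] /mem_lmap[x xb ->] /=.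
have kpx : entry a cs (q, dom b) p x by exists b.
have [_ pb] := entry_key kpx.
apply/hasP; exists (p, solved c (vr (q, dom b) p)); first by apply/mapP; exists p.
rewrite /= eqxx /=; have [ukp|nukp] := pselect (uniq_out c (q, dom b) p); last first.
  rewrite /solved; case: ifP => [|_ //].
  by case/knownP => k [p' [/vr_inj[<- <-] _ _]].
have zk : vr (q, dom b) p \in known c by apply: mem_known.
rewrite /solved zk unk_theta //=; apply/andP; split.
  rewrite unkE; apply/negP => /vars_tsubst[y /(entry_known ukp kpx)[i [z [-> ics zki]]]].
  rewrite joint_known // -unkE unk_ren unk_theta //; exact: cs_realizable.
have -> : tsubst (nth (Var 0) (mkseq tau (\max_(y <- known c) y).+1)) (theta c (vr (q, dom
    b) p))
    = tsubst (joint cs) (tsubst ch (theta c (vr (q, dom b) p))).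
  rewrite /tsubst gfold_tsubst; apply: eq_in_gfold => y /th4 yc.
  by rewrite nth_mkseq // ltnS; apply: (leq_bigmax_seq (F := id)).
(* It remains to compare values, for independent valuations [ws] of the arguments. *)
apply/eqP/joint_valid; first exact: cs_realizable.
  move=> y; rewrite mem_cat => /orP[|/vars_tsubst[z /th4/Hch[k [p' [_ ukp' kpz]]]]].
    exact: (entry_known ukp kpx).
  exact: (entry_known ukp' kpz).
move=> ws Hws; have szcs : size cs = size ss by rewrite -ss_cs size_map.
have [sv Hsv] : exists sv : nat -> tree * (nat -> tree), forall i, i < size cs ->
    [/\ in_T S (sv i).1, cl (sv i).1 = nth [::] cs i, selects (sv i).1 (sv i).2 &
      forall x, ws i x = if x \in known (nth [::] cs i) then (sv i).2 x else Nd 0 [::]].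
  apply: (@fun_choice _ _ (fun i (sv : tree * (nat -> tree)) => i < size cs ->
    [/\ in_T S sv.1, cl sv.1 = nth [::] cs i, selects sv.1 sv.2 &
      forall x, ws i x = if x \in known (nth [::] cs i) then sv.2 x else Nd 0 [::]])) => i.
  have [/Hws[s [v [? ? ? ?]]]|_] := boolP (i < size cs); first by exists (s, v).
  by exists (Nd 0 [::], fun=> Nd 0 [::]).
have Hsv' j (jss : j < size ss) := Hsv j (eq_ind_r (fun n => j < n) jss szcs).
(* Each [ws i] comes from an input of the i-th class; together these inputs form a tree of class
   [c], on which entries evaluate to actual results. *)
pose ss' := mkseq (fun i => (sv i).1) (size ss).
have szss' : size ss' = size ss by rewrite size_mkseq.
have nth_ss' j : j < size ss -> nth (Nd 0 [::]) ss' j = (sv j).1.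
  by move=> jss; rewrite nth_mkseq.
have ss'_cs : map cl ss' = cs.
  apply: (@eq_from_nth _ [::]); first by rewrite size_map szss' szcs.
  move=> j; rewrite size_map szss' => jss; rewrite (nth_map (Nd 0 [::])) ?szss' // nth_ss' //.
  by have [_ ->] := Hsv' j jss.
have clc : cl (Nd a ss') = c by rewrite /c (step_cl a ss'_cs) (step_cl a ss_cs).
have S' : in_T S (Nd a ss').
  apply: in_T_step => // j jss; rewrite nth_ss' //.
  by have [] := Hsv' j jss.
pose vs' i := (sv i).2.
have Hvs' j : j < size ss' -> selects (nth (Nd 0 [::]) ss' j) (vs' j).
  by rewrite szss' => jss; rewrite nth_ss' //; have [] := Hsv' j jss.
have ev x1 : (forall y, y \in vars x1 -> known_in cs y) ->
    eval (merge_val ws) x1 = eval (merge_val vs') x1.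
  move=> kx1; apply: eq_in_gfold => y /kx1[i [z [-> ics zki]]].
  rewrite /merge_val markK ?(known_gt0 zki) //=.
  by have [_ _ _ ->] := Hsv i ics; rewrite zki.
(* Known triples have a unique result on this tree, so any selection agrees with all their entries;
   it also supplies a valuation under which [theta c] takes the right values. *)
have [v Hv] := selects_inh (Nd a ss').
have Hw : vals c (fun z => if z \in known c then v z else Nd 0 [::]).
  by rewrite -clc; apply: selects_vals.
have Hvc := Hv; rewrite /selects clc in Hvc.
have vch z : z \in known c -> v z = eval (merge_val ws) (ch z).
  move=> /[dup] zc /Hch[k [p' [ez uk kpz]]].
  have [kc' pk'] := entry_key kpz.
  have [t1 [r1 ty1 o1]] := Hvc k kc'.
  have [t2 [r2 ty2 o2]] := entry_realized ss'_cs Hvs' kpz.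
  rewrite ev; last by move=> y; apply: (entry_known uk kpz).
  by rewrite {1}ez; apply: (uk (Nd a ss') t1 t2) => //; apply: o1.
have vx : v (vr (q, dom b) p) = eval (merge_val ws) x.
  have [t1 [r1 ty1 o1]] := Hvc (q, dom b) kc.
  have [t2 [r2 ty2 o2]] := entry_realized ss'_cs Hvs' kpx.
  rewrite ev; last by move=> y; apply: (entry_known ukp kpx).
  by apply: (ukp (Nd a ss') t1 t2) => //; apply: o1.
rewrite -vx; have := th1 _ (vr (q, dom b) p) Hw; rewrite zk => <-.
rewrite /eval gfold_tsubst; apply: eq_in_gfold => y /th4 yc.
by rewrite yc vch.
Qed.

End Covered.

(** Functionality makes the triples of the initial states known, so final terms are never
    unknown. *)
Lemma uniq_out_start c P : uniq_out c (q0, P) p0.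
Proof.
move=> s t t' u u' sS _ Ht _ Ht' _ Hu Hu'.
by apply: (functional sS); [exists t | exists t'].
Qed.

Lemma solved_finals c x : realizable c -> x \in finals q0 p0 (generic (solved c) c) ->
  exists P, [/\ vr (q0, P) p0 \in known c & x = theta c (vr (q0, P) p0)].
Proof.
move=> rc /mem_finals[b /mem_generic[P kc ->] /mapP[p pP [ep ->]]]; subst p.
have zk : vr (q0, P) p0 \in known c by apply: mem_known => //; apply: uniq_out_start.
by exists P; rewrite /solved zk.
Qed.

(** For different [P] and [P'] the two variables have equal values on every input of the class, both
    values being results of the composition. The equation is valid, hence the solution identifies
    the two terms. *)
Lemma solved_final_cert (c : class) : realizable c ->
  all (fun x => ~~ unk x && all (fun y => y == x) (finals q0 p0 (generic (solved c) c)))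
    (finals q0 p0 (generic (solved c) c)).
Proof.
move=> rc; apply/allP => x /(solved_finals rc)[P [zk ->]]; rewrite unk_theta //=.
apply/allP => y /(solved_finals rc)[P' [zk' ->]]; apply/eqP.
have [_ th2 _ _] := thetaP rc.
apply: (th2 (Var (vr (q0, P') p0)) (Var (vr (q0, P) p0))) => w [s [v [sS cs Hv Hw]]].
rewrite -[LHS]/(w _) -[RHS]/(w _) !Hw zk zk'.
have out P1 : vr (q0, P1) p0 \in known c -> composed R1 R2 q0 p0 s (v (vr (q0, P1) p0)).
  case/knownP => k [p [/vr_inj[<- <-] kc pk _]]; rewrite -cs in kc.
  by have [t [Ht _ Hp]] := Hv _ kc; exists t => //; apply: Hp.
by apply: (functional sS); apply: out.
Qed.

End Solved.

Lemma collect (X Y : eqType) (P : X -> Y -> Prop) (l : seq X) :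
  (forall x, x \in l -> exists y, P x y) ->
  exists L : seq Y, forall x, x \in l -> exists2 y, y \in L & P x y.
Proof.
elim: l => [|x l IH] H; first by exists [::].
have [y xy] := H x (mem_head _ _).
have [|L HL] := IH; first by move=> z zl; apply: H; rewrite inE zl orbT.
exists (y :: L) => z; rewrite inE => /orP[/eqP->|/HL[w wL zw]].
  by exists y; rewrite ?mem_head.
by exists w; rewrite // inE wL orbT.
Qed.

Lemma cert_complete : exists c : cert, closed_cert S R1 R2 c /\ final_cert q0 p0 c.
Proof.
have [theta thetaP] := exists_solution.
pose sitem c := generic (solved theta c) c.
(* Classes are sublists of [keys], hence finitely many. Only realizable ones have valuations, and
   with them a solution. *)
pose classes := [seq c <- sublists keys | `[< realizable c >]].
have rcl c : c \in classes -> realizable c by rewrite mem_filter => /andP[/asboolP].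
have clr s : in_T S s -> cl s \in classes.
  by move=> sS; rewrite mem_filter mem_sublists andbT; apply/asboolP; exists s.
pose items := map sitem classes.
pose args := [seq (ak, Is) | ak <- S, Is <- prods (nseq ak.2 items)].
(* Finitely many symbols with argument items: one substitution for each makes up the pool. *)
have [x|taus Htaus] := @collect _ _ (fun (x : nat * nat * seq item) (s : seq term) =>
   has (fun J => covered (trans R1 R2 x.1.1 (rename x.2)) J (nth (Var 0) s)) items) args.
  case/allpairsPdep => -[a k] [Is [aS /prods_nseqP[sIs sub] ->]] /=.
  have [cs csr eIs] : exists2 cs, {subset cs <= classes} & Is = map sitem cs.
    elim: Is sub {sIs} => [|J Is IH] sub; first by exists [::].
    have /mapP[c cc ->] := sub J (mem_head _ _).
    have [|cs csr ->] := IH; first by move=> K KIs; apply: sub; rewrite inE KIs orbT.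
    by exists (c :: cs) => // c'; rewrite inE => /orP[/eqP->|/csr].
  have [ss [Hss ssS]] : exists ss, map cl ss = cs /\ forall s, List.In s ss -> in_T S s.
    elim: cs csr {eIs} => [|c cs IH] csr; first by exists [::].
    have [s sS sc] := rcl _ (csr c (mem_head _ _)).
    have [|ss [<- ssS]] := IH; first by move=> c' c'cs; apply: csr; rewrite inE c'cs orbT.
    by exists (s :: ss); rewrite /= sc; split=> // s' [<-|/ssS].
  have aS' : (a, size ss) \in S by rewrite -(size_map cl) Hss -(size_map sitem) -eIs sIs.
  have [s Hs] := step_covered thetaP Hss ssS aS'.
  exists s; apply/hasP; exists (sitem (cl (Nd a ss))); last by rewrite eIs.
  by apply/map_f/clr/(c_in_T ssS aS').
exists (items, taus); split.
  apply/allP => -[a k] aS; apply/allP => Is HIs.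
  have [|s st /hasP[J Ji cov]] := Htaus ((a, k), Is); first by apply/allpairsPdep;
    exists (a, k), Is.
  by apply/hasP; exists J => //; apply/hasP; exists s.
by apply/allP => _ /mapP[c cc ->]; apply: (solved_final_cert thetaP); apply: rcl.
Qed.

End Completeness.

(** * Derivations and runs *)

Section Semantics.
Variable T : tdt.
Hypothesis wfT : tdt_wf T.

Lemma rank_inj (S : ralph) a k l : ralph_wf S -> (a, k) \in S -> (a, l) \in S -> k = l.
Proof.
rewrite /ralph_wf; elim: S => //= -[b m] S IH /andP[bS uS]; rewrite !inE.
have nb n : (b, n) \in S -> False by move=> /(map_f fst) /=; apply/negP.
move=> /orP[/eqP e1|H1] /orP[/eqP e2|H2].
- by case: e1 => _ ->; case: e2 => _ ->.
- by case: e1 => ea _; rewrite ea in H2; case: (nb _ H2).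
- by case: e2 => ea _; rewrite ea in H1; case: (nb _ H1).
- exact: IH H1 H2.
Qed.

Lemma rhs_ok_Leaf Q D k q i : rhs_ok Q D k (GenTree.Leaf (q, i)) -> i < k.
Proof. by inversion 1. Qed.

Lemma rhs_ok_Node Q D k b cs : rhs_ok Q D k (GenTree.Node b cs) ->
  (b, size cs) \in D /\ Forall (rhs_ok Q D k) cs.
Proof. by inversion 1. Qed.

(* The final trees of a sentential form; ill-ranked calls are left unconstrained. *)
Fixpoint den (x : sform) : tree -> Prop :=
  match x with
  | SCall q s => fun t => in_T (tin T) s -> run (trules T) s q t
  | SNd b xs => fun t => exists2 ts, t = Nd b ts &
                          Forall2 (fun P u => P u) (map den xs) ts
  end.

Lemma den_to_sform t : den (to_sform t) t.
Proof.
elim/tree_Forall_ind: t => a ts H /=; exists ts => //.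
by rewrite -map_comp; elim: H => //= *; constructor.
Qed.

Lemma den_inst ss Q D r t : Forall (in_T (tin T)) ss -> rhs_ok Q D (size ss) r ->
  den (inst ss r) t ->
  inst_rel (fun x => nth (fun _ _ => False) (map (run (trules T)) ss) x.2 x.1) r t.
Proof.
move=> Hss; elim/gtree_ind: r t => [[q i]|b rs IH] t /=.
  move/rhs_ok_Leaf => iss; rewrite (nth_map (Nd 0 [::])) //; apply.
  by elim: Hss i iss => //= s ss' sS _ IHss [|i] //; apply: IHss.
case/rhs_ok_Node => _ Hok [ts -> Hts]; exists ts => //; rewrite -map_comp in Hts.
elim: rs ts IH Hts Hok => [|r rs IHrs] ts IH Hts Hok; inversion Hts; subst.
  by constructor.
inversion Hok; subst; constructor; first by apply: IH; rewrite ?mem_head.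
by apply: IHrs => // r' r'rs; apply: IH; rewrite inE r'rs orbT.
Qed.

(** Results are pulled back along rewriting: what the reduct denotes, the redex denotes too. Applied
    to a whole derivation, this starts from the output tree, which denotes itself. *)
Lemma den_step x y : tstep T x y -> forall t, den y t -> den x t.
Proof.
elim=> {x y} [q a ss r rT t Hd /in_T_Nd[aS Hss]|b l x y rs _ IH t [ts -> Hts]].
  have [_ wfin _ _ /(_ _ _ _ rT)[_ [k [ak ok]]]] := wfT.
  exists r => //; apply: den_inst Hd => //.
  (* The rule was checked against the declared rank of [a]; ranks being unique, this is the number
     of subtrees, and all variables are in range. *)
  by rewrite (rank_inj wfin aS ak); apply: ok.
exists ts => //; elim: l ts Hts => [|z l IHl] ts /= Hts; inversion Hts; subst.
  by constructor; first exact: IH.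
by constructor; last exact: IHl.
Qed.

Lemma den_steps x y : clos_refl_trans sform (tstep T) x y -> forall t, den y t -> den x t.
Proof. by elim=> {x y} [x y /den_step|//|x y z _ IH1 _ IH2 t /IH2/IH1]. Qed.

Lemma steps_SNd b l xs ys : Forall2 (clos_refl_trans sform (tstep T)) xs ys ->
  clos_refl_trans sform (tstep T) (SNd b (l ++ xs)) (SNd b (l ++ ys)).
Proof.
move=> H; elim: H l => [|x y xs' ys' xy _ IH] l; first exact: rt_refl.
apply: (rt_trans _ _ _ (SNd b (l ++ y :: xs'))).
  elim: xy => {x y} [x y xy|x|x y z _ IH1 _ IH2].
  - exact/rt_step/step_ctx.
  - exact: rt_refl.
  - exact: rt_trans IH1 IH2.
by have := IH (rcons l y); rewrite !cat_rcons.
Qed.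

Lemma run_steps s q t : run (trules T) s q t ->
  clos_refl_trans sform (tstep T) (SCall q s) (to_sform t).
Proof.
elim/tree_Forall_ind: s q t => a ss IH q t [r rT Hr].
apply: (rt_trans _ _ _ (inst ss r)); first exact/rt_step/step_root.
elim/gtree_ind: r t {rT} Hr => [[p i]|b rs IHr] t /=.
  by elim: IH i => [|s ss' Hs _ IHss] [|i] //=; [exact: Hs | exact: IHss].
case=> ts -> Hts; apply: (steps_SNd b [::]).
elim: rs ts Hts IHr => [|r rs IHrs] ts Hts IHr; inversion Hts; subst; constructor.
  by apply: IHr; rewrite ?mem_head.
by apply: IHrs => // r' r'rs; apply: IHr; rewrite inE r'rs orbT.
Qed.

Lemma run_in_T s q t : run (trules T) s q t -> in_T (tout T) t.
Proof.
elim/tree_Forall_ind: s q t => a ss IH q t [r rT Hr].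
have [_ _ _ _ /(_ _ _ _ rT)[_ [k [_ ok]]]] := wfT.
elim/gtree_ind: r t ok {rT} Hr => [[p i]|b rs IHr] t ok /=.
  by elim: IH i {ok} => [|s ss' Hs _ IHss] [|i] //=; [exact: Hs | exact: IHss].
have [bD Hok] := rhs_ok_Node ok; case=> ts -> Hts.
apply/in_T_Nd; split; first by rewrite -(Forall2_size Hts) size_map.
elim: rs ts Hts IHr Hok {ok bD} => [|r rs IHrs] ts Hts IHr Hok; inversion Hts; subst.
  by constructor.
inversion Hok; subst; constructor; first exact: (IHr r (mem_head _ _)).
by apply: IHrs => // r' r'rs; apply: IHr; rewrite inE r'rs orbT.
Qed.

Lemma trel_run s t :
  trel T s t <-> in_T (tin T) s /\ run (trules T) s (tinit T) t.
Proof.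
split=> [[sS [_ st]]|[sS st]].
  by split=> //; apply: (den_steps st (den_to_sform t)).
by split=> //; split; [apply: run_in_T st | apply: run_steps].
Qed.

End Semantics.

Lemma eq_in_T (S S' : ralph) t : S =i S' -> in_T S t -> in_T S' t.
Proof.
move=> SS'; elim/tree_Forall_ind: t => a ts IH /in_T_Nd[aS Hts]; apply/in_T_Nd.
rewrite -SS'; split=> //; elim: Hts IH {aS} => [|u us uS _ IHus] IH; constructor;
  by inversion IH; subst; auto.
Qed.

Lemma functional_unique T1 T2 : tdt_wf T1 -> tdt_wf T2 -> tout T1 =i tin T2 ->
  functional_rel (rcomp (trel T1) (trel T2)) <->
  unique_on (tin T1) (trules T1) (trules T2) (tinit T1) (tinit T2).
Proof.
move=> wf1 wf2 T12; have comp s u : rcomp (trel T1) (trel T2) s u <->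
    in_T (tin T1) s /\ composed (trules T1) (trules T2) (tinit T1) (tinit T2) s u.
  split=> [[t [/(trel_run wf1)[sS st] /(trel_run wf2)[_ tu]]]|[sS [t st tu]]].
    by split=> //; exists t.
  exists t; split; first by apply/(trel_run wf1).
  by apply/(trel_run wf2); split=> //; apply: eq_in_T T12 (run_in_T wf1 st).
split=> [F s sS u u' su su'|U s u u' /comp[sS su] /comp[_ su']].
  by apply: (F s); apply/comp.
exact: (U s).
Qed.

(** * The search program *)

Lemma comp_lookup (C V : countType) (q : C -> nat) (I : C -> seq (nat * V)) :
  computable q -> computable I -> computable (fun c => lookup (q c) (I c)).
Proof.
move=> Hq HI; apply: (comp_map (f := fun _ e => e.2)); first by comp_auto.
apply: (comp_filter (f := fun c e => e.1 == q c)) => //.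
by comp_auto; apply: (comp_comp Hq); comp_auto.
Qed.

Lemma comp_fire (C V : countType) (nd : C -> nat -> seq V -> V) (R : C -> rules)
    (a : C -> nat) (Is : C -> seq (seq (nat * V))) :
  computable (fun t => nd t.1 t.2.1 t.2.2) -> computable R -> computable a -> computable Is ->
  computable (fun c => fire (nd c) (R c) (a c) (Is c)).
Proof.
move=> Hnd HR Ha HI; apply: comp_flatten.
apply: (comp_map (f := fun c rl => [seq (rl.1.1, v) | v <-
  choices (fun x => lookup x.1 (nth [::] (Is c) x.2)) (nd c) rl.2])); last first.
  apply: (comp_filter (f := fun c (rl : nat * nat * rhs) => rl.1.2 == a c)) => //.
  by comp_auto; apply: (comp_comp Ha); comp_auto.
apply: (comp_map (f := fun (t : C * (nat * nat * rhs)) v => (t.2.1.1, v))).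
  by comp_auto.
apply: (comp_gfold (leaf := fun (t : C * (nat * nat * rhs)) x =>
    lookup x.1 (nth [::] (Is t.1) x.2))
  (node := fun t n vs => [seq nd t.1 n us | us <- prods vs])).
- apply: comp_lookup; first by comp_auto.
  apply: comp_nth; comp_auto; apply: (comp_comp HI); comp_auto.
- apply: (comp_map (f := fun (t : C * (nat * nat * rhs) * (nat * seq (seq V))) us =>
    nd t.1.1 t.2.1 us)).
    by apply: (comp_comp3 Hnd); comp_auto.
  by apply: comp_prods; comp_auto.
- by comp_auto.
Qed.

Lemma comp_trans (C : countType) (R1 R2 : C -> rules) (a : C -> nat) (Is : C -> seq item) :
  computable R1 -> computable R2 -> computable a -> computable Is ->
  computable (fun c => trans (R1 c) (R2 c) (a c) (Is c)).
Proof.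
move=> H1 H2 Ha HI; apply: (comp_fire (nd := fun c => fire App (R2 c))) => //.
apply: (comp_fire (nd := fun _ => App)); comp_auto.
- by apply: comp_Node; comp_auto.
- by apply: (comp_comp H2); comp_auto.
Qed.

Lemma comp_tsubst (C : countType) (s : C -> nat -> term) (t : C -> term) :
  computable (fun x => s x.1 x.2) -> computable t ->
  computable (fun c => tsubst (s c) (t c)).
Proof.
move=> Hs Ht; apply: (comp_gfold (node := fun _ => App)) => //.
by apply: comp_Node; comp_auto.
Qed.

Lemma comp_unk (C : countType) (t : C -> term) :
  computable t -> computable (fun c => unk (t c)).
Proof.
move=> Ht; apply: (comp_has (f := fun _ x => x == 0)); first by comp_auto.
apply: (comp_gfold (leaf := fun _ x => [:: x]) (node := fun _ _ vs => flatten vs)) => //.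
  by comp_auto.
by apply: comp_flatten; comp_auto.
Qed.

Lemma comp_lmap (C V W : countType) (h : C -> V -> W) (I : C -> seq (nat * V)) :
  computable (fun x => h x.1 x.2) -> computable I ->
  computable (fun c => lmap (h c) (I c)).
Proof.
move=> Hh HI; apply: (comp_map (f := fun c e => (e.1, h c e.2))) => //.
by comp_auto; apply: (comp_comp2 Hh); comp_auto.
Qed.

Lemma comp_mark : computable (fun x : nat * nat => mark x.1 x.2).
Proof.
apply: (comp_nat_case (n := fun x : nat * nat => x.2) (g := fun x y => (pickle (x.1, y)).+1)).
- by comp_auto.
- by comp_auto.
- by apply: comp_succ; apply: (proj1 (comp_pickle _)); comp_auto.
Qed.

Lemma comp_rename (C : countType) (Is : C -> seq item) :
  computable Is -> computable (fun c => rename (Is c)).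
Proof.
move=> HI; apply: (comp_map (f := fun c i => item_map (fun x => Var (mark i x)) (nth [::]
    (Is c) i))).
  apply: (comp_lmap (h := fun t : C * nat => beh_map (fun x => Var (mark t.2 x)))).
    apply: (comp_lmap (h := fun t : C * nat * beh => tsubst (fun x => Var (mark t.1.2 x)))).
      apply: (comp_tsubst (s := fun t x => Var (mark t.1.1.2 x))); last by comp_auto.
      by apply: comp_Leaf; apply: (comp_comp2 comp_mark); comp_auto.
    by comp_auto.
  by apply: comp_nth; comp_auto; apply: (comp_comp HI); comp_auto.
by apply: comp_iota; apply: comp_size.
Qed.

Lemma comp_covered (C : countType) (I J : C -> item) (s : C -> nat -> term) :
  computable I -> computable J -> computable (fun x => s x.1 x.2) ->
  computable (fun c => covered (I c) (J c) (s c)).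
Proof.
move=> HI HJ Hs.
apply: (comp_all (f := fun c e => has (fun e' => (e.1 == e'.1) &&
    all (fun x => has (fun x' => (x.1 == x'.1) &&
       (unk x'.2 || (~~ unk x.2 && (x.2 == tsubst (s c) x'.2)))) e'.2) e.2) (J c))) => //.
apply: (comp_has (f := fun (t : C * (nat * beh)) e' => (t.2.1 == e'.1) &&
    all (fun x => has (fun x' => (x.1 == x'.1) &&
       (unk x'.2 || (~~ unk x.2 && (x.2 == tsubst (s t.1) x'.2)))) e'.2) t.2.2)); last first.
  by apply: (comp_comp HJ); comp_auto.
apply: comp_and; first by comp_auto.
apply: (comp_all (f := fun (t : C * (nat * beh) * (nat * beh)) x =>
   has (fun x' => (x.1 == x'.1) &&
       (unk x'.2 || (~~ unk x.2 && (x.2 == tsubst (s t.1.1) x'.2)))) t.2.2)); last by comp_auto.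
apply: (comp_has (f := fun (t : C * (nat * beh) * (nat * beh) * (nat * term)) x' =>
   (t.2.1 == x'.1) &&
       (unk x'.2 || (~~ unk t.2.2 && (t.2.2 == tsubst (s t.1.1.1) x'.2))))); last by comp_auto.
apply: comp_and; first by comp_auto.
apply: comp_or; first by apply: comp_unk; comp_auto.
apply: comp_and; first by apply: comp_negb; apply: comp_unk; comp_auto.
apply: comp_eq; first by comp_auto.
apply: comp_tsubst; last by comp_auto.
by apply: (comp_comp2 Hs); comp_auto.
Qed.

Lemma comp_closed_cert (C : countType) (S : C -> ralph) (R1 R2 : C -> rules) (c : C -> cert) :
  computable S -> computable R1 -> computable R2 -> computable c ->
  computable (fun x => closed_cert (S x) (R1 x) (R2 x) (c x)).
Proof.
move=> HS H1 H2 Hc.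
apply: (comp_all (f := fun x ak => all (fun Is => has (fun J => has (fun s =>
      covered (trans (R1 x) (R2 x) ak.1 (rename Is)) J (nth (Var 0) s)) (c x).2) (c x).1)
    (prods (nseq ak.2 (c x).1)))) => //.
apply: (comp_all (f := fun (t : C * (nat * nat)) Is => has (fun J => has (fun s =>
      covered (trans (R1 t.1) (R2 t.1) t.2.1 (rename Is)) J (nth (Var 0) s)) (c t.1).2) (c
          t.1).1)); last first.
  apply: comp_prods; apply: comp_nseq; first by comp_auto.
  by apply: comp_fst; apply: (comp_comp Hc); comp_auto.
apply: (comp_has (f := fun (t : C * (nat * nat) * seq item) J => has (fun s =>
      covered (trans (R1 t.1.1) (R2 t.1.1) t.1.2.1 (rename t.2)) J (nth (Var 0) s)) (c
          t.1.1).2)); last first.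
  by apply: comp_fst; apply: (comp_comp Hc); comp_auto.
apply: (comp_has (f := fun (t : C * (nat * nat) * seq item * item) s =>
      covered (trans (R1 t.1.1.1) (R2 t.1.1.1) t.1.1.2.1 (rename t.1.2)) t.2 (nth (Var 0) s)));
        last first.
  by apply: comp_snd; apply: (comp_comp Hc); comp_auto.
apply: comp_covered.
- apply: comp_trans.
  + by apply: (comp_comp H1); comp_auto.
  + by apply: (comp_comp H2); comp_auto.
  + by comp_auto.
  + by apply: comp_rename; comp_auto.
- by comp_auto.
- by apply: comp_nth; comp_auto.
Qed.

Lemma comp_finals (C : countType) (q p : C -> nat) (I : C -> item) :
  computable q -> computable p -> computable I ->
  computable (fun x => finals (q x) (p x) (I x)).
Proof.
move=> Hq Hp HI; apply: comp_flatten; apply: (comp_map (f := fun x b => lookup (p x) b)).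
  by apply: comp_lookup; comp_auto; apply: (comp_comp Hp); comp_auto.
exact: comp_lookup.
Qed.

Lemma comp_final_cert (C : countType) (q p : C -> nat) (c : C -> cert) :
  computable q -> computable p -> computable c ->
  computable (fun x => final_cert (q x) (p x) (c x)).
Proof.
move=> Hq Hp Hc.
apply: (comp_all (f := fun x I => all (fun y => ~~ unk y &&
    all (fun z => z == y) (finals (q x) (p x) I)) (finals (q x) (p x) I)));
      last exact: comp_fst.
apply: (comp_all (f := fun (t : C * item) y => ~~ unk y &&
    all (fun z => z == y) (finals (q t.1) (p t.1) t.2))); last first.
  by apply: comp_finals; comp_auto; [apply: (comp_comp Hq) | apply: (comp_comp Hp)]; comp_auto.
apply: comp_and; first by apply: comp_negb; apply: comp_unk; comp_auto.
apply: (comp_all (f := fun (t : C * item * term) z => z == t.2)); first by comp_auto.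
by apply: comp_finals; comp_auto; [apply: (comp_comp Hq) | apply: (comp_comp Hp)]; comp_auto.
Qed.

Lemma comp_level (C : countType) (S : C -> ralph) (R1 R2 : C -> rules) (n : C -> nat) :
  computable S -> computable R1 -> computable R2 -> computable n ->
  computable (fun x => level (S x) (R1 x) (R2 x) (n x)).
Proof.
move=> HS H1 H2 Hn.
apply: (comp_iter (g := fun x E => flatten [seq [seq trans (R1 x) (R2 x) ak.1 Is |
   Is <- prods (nseq ak.2 E)] | ak <- S x])) => //; last exact: comp_const.
apply: comp_flatten; apply: (comp_map (f := fun (t : C * seq item) ak =>
   [seq trans (R1 t.1) (R2 t.1) ak.1 Is | Is <- prods (nseq ak.2 t.2)])); last first.
  by apply: (comp_comp HS); comp_auto.
apply: (comp_map (f := fun (t : C * seq item * (nat * nat)) Is =>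
   trans (R1 t.1.1) (R2 t.1.1) t.2.1 Is)); last first.
  by apply: comp_prods; apply: comp_nseq; comp_auto.
by apply: comp_trans; comp_auto; [apply: (comp_comp H1) | apply: (comp_comp H2)]; comp_auto.
Qed.

Lemma comp_conflict (C : countType) (q p : C -> nat) (I : C -> item) :
  computable q -> computable p -> computable I ->
  computable (fun x => conflict (q x) (p x) (I x)).
Proof.
move=> Hq Hp HI.
apply: (comp_has (f := fun x y => has (fun z => y != z) (finals (q x) (p x) (I x))));
  last first.
  exact: comp_finals.
apply: (comp_has (f := fun (t : C * term) z => t.2 != z)); first by comp_auto.
by apply: comp_finals; [apply: (comp_comp Hq) | apply: (comp_comp Hp) | apply: (comp_comp HI)];
  comp_auto.
Qed.

Lemma enum_cert : enumerable cert.
Proof.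
have Et : enumerable term := enum_tree enum_nat 0.
apply: enum_prod; last exact/enum_seq/enum_seq.
by apply/enum_seq/enum_seq/enum_prod/enum_seq/enum_prod => //; apply: enum_nat.
Qed.

(** [PMu] stops at the first zero, so it runs on the negated test; [res] is then evaluated at the
    index found. *)
Lemma search_program (A : countType) (test res : nat * A -> bool) :
  computable test -> computable res -> exists p, forall a n,
    test (n, a) -> (forall m, m < n -> ~~ test (m, a)) ->
    peval p [:: pickle a] (res (n, a) : nat).
Proof.
move=> /comp_negb[pt Ht] [pr Hr]; have [mkp Hmkp] := pair_program.
pose pp := mkp (PProj 0) (PProj 1).
have Hpp n x : peval pp [:: n; x] (ccons n (ccons x 0)).
  by apply: Hmkp; [apply: (@ev_proj 0 [:: n; x]) | apply: (@ev_proj 1 [:: n; x])].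
have Htp m a : peval (PComp pt [:: pp]) [:: m; pickle a] (~~ test (m, a) : nat).
  apply: (ev_comp (ys := [:: pickle (m, a)])); last first.
    by have := Ht (m, a); case: (~~ _).
  exact: evs_cons (Hpp m (pickle a)) (evs_nil _).
exists (PComp pr [:: PComp pp [:: PMu (PComp pt [:: pp]); PProj 0]]) => a n tn lt_n.
apply: (ev_comp (ys := [:: pickle (n, a)])); last first.
  by have := Hr (n, a); case: (res _).
apply: evs_cons (evs_nil _); apply: (ev_comp (ys := [:: n; pickle a])); last exact: Hpp.
apply: evs_cons.
  apply: ev_mu; first by have := Htp n a; rewrite tn.
  by move=> m /lt_n ntm; exists 0; have := Htp m a; rewrite ntm.
by apply: evs_cons (evs_nil _); apply: (@ev_proj 0 [:: pickle a]).
Qed.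

(* Decidability: a single mu-recursive program decides, on the (standard
   MathComp `pickle`) code of any admissible pair (T1, T2), whether
   R(T1) o R(T2) is functional. *)
Theorem theorem1 :
  exists p : prf,
    forall T1 T2 : tdt,
      tdt_wf T1 -> tdt_wf T2 -> tout T1 =i tin T2 ->
      (functional_rel (rcomp (trel T1) (trel T2)) ->
         peval p [:: @pickle _ (pair T1 T2)] 1) /\
      (~ functional_rel (rcomp (trel T1) (trel T2)) ->
         peval p [:: @pickle _ (pair T1 T2)] 0).
Proof.
have [dec Hdec sdec] := enum_cert.
pose res (x : nat * (tdt * tdt)) :=
  closed_cert (tin x.2.1) (trules x.2.1) (trules x.2.2) (dec x.1) &&
  final_cert (tinit x.2.1) (tinit x.2.2) (dec x.1).
(* One index drives both searches, as the number of a certificate and as a level; [res] tells which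
   kind of witness was met. *)
pose test (x : nat * (tdt * tdt)) := res x ||
  has (fun I => conflict (tinit x.2.1) (tinit x.2.2) I)
    (level (tin x.2.1) (trules x.2.1) (trules x.2.2) x.1).
have Hdec' : computable (fun x : nat * (tdt * tdt) => dec x.1).
  by apply: (comp_comp Hdec); comp_auto.
have Hres : computable res.
  apply: comp_and.
    by apply: comp_closed_cert => //; rewrite /tin /trules; comp_auto.
  by apply: comp_final_cert => //; rewrite /tinit; comp_auto.
have Htest : computable test.
  apply: comp_or => //.
  apply: (comp_has (f := fun x : nat * (tdt * tdt) => conflict (tinit x.2.1) (tinit x.2.2))).
    by apply: comp_conflict; rewrite /tinit; comp_auto.
  by apply: comp_level; rewrite /tin /trules; comp_auto.
have [p Hp] := search_program Htest Hres; exists p => T1 T2 wf1 wf2 T12.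
rewrite (functional_unique wf1 wf2 T12).
set U := unique_on _ _ _ _ _.
have resU n : res (n, (T1, T2)) -> U by case/andP; apply: cert_sound.
have ex : exists n, test (n, (T1, T2)).
  (* The case distinction, not decided by the program, only shows that its search stops. *)
  have [/cert_complete[c [c1 c2]]|/conflictP[n Hn]] := pselect U.
    by have [n en] := sdec c; exists n; rewrite /test /res /= en c1 c2.
  by exists n; rewrite /test /= Hn orbT.
case: (ex_minnP ex) => m tm lt_m.
have {}lt_m k : k < m -> ~~ test (k, (T1, T2)).
  by move=> km; apply/negP => /lt_m; rewrite leqNgt km.
have Hpm := Hp _ _ tm lt_m; split=> HU.
  (* A conflict would refute [U], so the search has stopped at a certificate. *)
  suff r : res (m, (T1, T2)) by rewrite r in Hpm.
  case/orP: tm => // Hm; suff /(_ HU) : ~ U by [].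
  by apply/conflictP; exists m.
by have /negbTE r : ~~ res (m, (T1, T2)) by [apply/negP => /resU]; rewrite r in Hpm.
Qed.
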